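(* Let $M$ be an entire spacelike stationary graph in $\mathbb{R}^4_1$ generated by a smooth function $f=(f_1,f_2):\mathbb{R}^2\to\mathbb{R}^2_1$, i.e. $M=\{(x,f(x)):x\in\mathbb{R}^2\}$, with $W$-function $W$. If $W\le 1$ everywhere, or if $W\ge 1$ everywhere, then either $f$ is affine linear, or $f=h\,\mathbf{y}_0+\mathbf{y}_1$ with $h$ a nonlinear (i.e. not affine linear) harmonic function on $\mathbb{R}^2$, $\mathbf{y}_0$ a nonzero lightlike vector in $\mathbb{R}^2_1$ and $\mathbf{y}_1\in\mathbb{R}^2_1$ a constant vector. Moreover, if $W<1$ everywhere, or if $W>1$ everywhere, then $f$ is affine linear, so that $M$ is an affine plane in $\mathbb{R}^4_1$.
   Context: $\mathbb{R}^m_1$ denotes $\mathbb{R}^m$ with the Minkowski inner product $\langle \mathbf{u},\mathbf{v}\rangle=u_1v_1+\cdots+u_{m-1}v_{m-1}-u_mv_m$; a vector $\mathbf{y}$ is lightlike if $\langle\mathbf{y},\mathbf{y}\rangle=0$. Identify $\mathbb{R}^{2+m}_1=\mathbb{R}^2\oplus\mathbb{R}^m_1$, where $\mathbb{R}^2$ carries the Euclidean inner product. (Here $m=2$.) For smooth $f:\mathbb{R}^2\to\mathbb{R}^m_1$, put $p=\partial f/\partial x_1$, $q=\partial f/\partial x_2$. The induced metric on $M=\operatorname{graph} f\subset\mathbb{R}^{2+m}_1$ in the global coordinates $(x_1,x_2)$ is $g=g_{ij}dx_idx_j$ with $g_{11}=1+\langle p,p\rangle$, $g_{22}=1+\langle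 q,q\rangle$, $g_{12}=g_{21}=\langle p,q\rangle$. $M$ is spacelike if $(g_{ij})$ is positive definite at every point; then $W:=\det(g_{ij})^{1/2}>0$. A spacelike surface is stationary if its mean curvature vector field vanishes identically; equivalently, all coordinate functions of $\mathbb{R}^{2+m}_1$ restricted to $M$ are harmonic for the Laplace–Beltrami operator $\Delta F=W^{-1}\partial_i(Wg^{ij}\partial_jF)$ of $g$, where $(g^{ij})=(g_{ij})^{-1}$. ''Harmonic function on $\mathbb{R}^2$'' refers to the standard Euclidean Laplacian in $(x_1,x_2)$. *)

(* Defs.v *)
From Stdlib Require Import Reals Lra.
From Coquelicot Require Import Coquelicot.
Open Scope R_scope.

Definition R2 : Type := (R * R)%type.
(* The ambient space R^2 (+) R^2_1; the last of the four coordinates is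
   the timelike one. *)
Definition R4 : Type := (R2 * R2)%type.

Definition euclid (u v : R2) : R := fst u * fst v + snd u * snd v.
Definition mink (u v : R2) : R := fst u * fst v - snd u * snd v.
Definition mink4 (U V : R4) : R :=
  euclid (fst U) (fst V) + mink (snd U) (snd V).

Definition lightlike (y : R2) : Prop := mink y y = 0.

Inductive index : Set := i1 | i2.

Definition sum2 {V : ModuleSpace R_Ring} (F : index -> V) : V :=
  plus (F i1) (F i2).

(* Derive is total (junk value where the derivative does not exist); it is
   only meaningful under the smoothness hypotheses below. *)
Definition pd (i : index) (u : R2 -> R) (x : R2) : R :=
  match i with
  | i1 => Derive (fun t => u (t, snd x)) (fst x)
  | i2 => Derive (fun t => u (fst x, t)) (snd x)
  end.

Definition pd2 (i : index) (f : R2 -> R2) (x : R2) : R2 :=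
  (pd i (fun z => fst (f z)) x, pd i (fun z => snd (f z)) x).

Definition pd4 (i : index) (X : R2 -> R4) (x : R2) : R4 :=
  (pd2 i (fun z => fst (X z)) x, pd2 i (fun z => snd (X z)) x).

(* ex_diff_n u n a b: the partial derivatives of u up to order n exist and are
   continuous at (a, b). *)
Definition Ck (n : nat) (u : R2 -> R) : Prop :=
  forall a b : R, ex_diff_n (fun s t => u (s, t)) n a b.

Definition smooth (f : R2 -> R2) : Prop :=
  forall n : nat, Ck n (fun x => fst (f x)) /\ Ck n (fun x => snd (f x)).

Definition harmonic (h : R2 -> R) : Prop :=
  Ck 2 h /\ forall x : R2, pd i1 (pd i1 h) x + pd i2 (pd i2 h) x = 0.

Definition affine_linear {V : ModuleSpace R_Ring} (F : R2 -> V) : Prop :=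
  exists a b c : V, forall x : R2,
    F x = plus (plus (scal (fst x) a) (scal (snd x) b)) c.

Definition graph (f : R2 -> R2) (P : R4) : Prop :=
  exists x : R2, P = (x, f x).

Definition affine_plane (M : R4 -> Prop) : Prop :=
  exists P A B : R4,
    (forall s t : R, plus (scal s A) (scal t B) = zero -> s = 0 /\ t = 0) /\
    (forall Z : R4, M Z <->
       exists s t : R, Z = plus P (plus (scal s A) (scal t B))).

Definition immersion (f : R2 -> R2) (x : R2) : R4 := (x, f x).

Definition delta (i j : index) : R :=
  match i, j with i1, i1 | i2, i2 => 1 | _, _ => 0 end.

Definition metric (f : R2 -> R2) (x : R2) (i j : index) : R :=
  delta i j + mink (pd2 i f x) (pd2 j f x).

Lemma metric_induced (f : R2 -> R2) (x : R2) (i j : index) :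
  metric f x i j = mink4 (pd4 i (immersion f) x) (pd4 j (immersion f) x).
Proof.
  unfold metric, mink4; f_equal.
  destruct i, j; cbn; unfold euclid; cbn;
    rewrite ?Derive_id, ?Derive_const; ring.
Qed.

Definition spacelike (f : R2 -> R2) : Prop :=
  forall x v : R2, v <> (0, 0) ->
    0 < metric f x i1 i1 * fst v * fst v + metric f x i1 i2 * fst v * snd v
        + metric f x i2 i1 * snd v * fst v + metric f x i2 i2 * snd v * snd v.

Definition det_metric (f : R2 -> R2) (x : R2) : R :=
  metric f x i1 i1 * metric f x i2 i2 - metric f x i1 i2 * metric f x i2 i1.

Definition W (f : R2 -> R2) (x : R2) : R := sqrt (det_metric f x).

Definition inv_metric (f : R2 -> R2) (x : R2) (i j : index) : R :=
  match i, j with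
  | i1, i1 => metric f x i2 i2 / det_metric f x
  | i2, i2 => metric f x i1 i1 / det_metric f x
  | _, _ => - metric f x i j / det_metric f x
  end.

Lemma inv_metric_mul (f : R2 -> R2) (x : R2) (i k : index) : det_metric f x <> 0 ->
  inv_metric f x i i1 * metric f x i1 k + inv_metric f x i i2 * metric f x i2 k
  = delta i k.
Proof.
  unfold det_metric.
  assert (S : metric f x i2 i1 = metric f x i1 i2)
    by (unfold metric, mink; cbn; ring).
  intros D; destruct i, k; unfold inv_metric, det_metric;
    rewrite ?S in *; unfold delta; field; exact D.
Qed.

(* V - g^{kl} <V, X_k> X_l, the component of V normal to M at (x, f x). *)
Definition normal_part (f : R2 -> R2) (x : R2) (V : R4) : R4 :=
  minus V
    (sum2 (fun k => sum2 (fun l =>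
       scal (inv_metric f x k l * mink4 V (pd4 k (immersion f) x))
            (pd4 l (immersion f) x)))).

(* Since the ambient space is flat, the second fundamental form is the normal
   part of the second derivative of the immersion. *)
Definition second_fundamental_form (f : R2 -> R2) (x : R2) (i j : index) : R4 :=
  normal_part f x (pd4 i (pd4 j (immersion f)) x).

Definition mean_curvature (f : R2 -> R2) (x : R2) : R4 :=
  scal (1 / 2)
    (sum2 (fun i => sum2 (fun j =>
       scal (inv_metric f x i j) (second_fundamental_form f x i j)))).

Definition stationary (f : R2 -> R2) : Prop :=
  forall x : R2, mean_curvature f x = zero.

(* Main.v *)
Require Import Defs.
From Stdlib Require Import Reals Lra Classical.
From Coquelicot Require Import Coquelicot.
Open Scope R_scope.

(** Stationarity makes [A = g / W] a unimodular field with closed rows, i.e. the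
Hessian of a convex solution of [det D^2 E = 1] on the plane, and Joergens'
theorem says that [A] is constant: with [E_x = P], [E_y = Q], the functions
[x + i Q] and [P + i y] are holomorphic for the conformal structure of [A],
their sum is expanding, and a Liouville argument makes them affinely related.
Liouville arguments are run in the original coordinates, by applying the
maximum principle to quotients of moduli of holomorphic functions, so neither
global uniformization nor contour integrals are needed.

With [A] constant, the null coordinates [f1 - f2] and [f1 + f2] are harmonic
after a linear change of variables, and [g(d, d) = W A(d, d)] reads
[|d|^2 + D_d (f1 - f2) D_d (f1 + f2) = W A(d, d)]. If [A <> I], a bound on [W]
by [1] yields a direction [d] in which neither derivative vanishes; a
holomorphic function with non-vanishing real part is constant, so [f] is affine.
If [A = I], the gradients of the two null coordinates have product zero as
holomorphic functions, so one of them is constant, and [W = 1]. *)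

(** * Differentiability in the plane *)

(** The rows of [A] are closed because the coordinates [x] and [y] are harmonic on the surface:
    [W g^{ij}] is the adjugate of [g / W], so [d_i (W g^{ij}) = 0] is exactly closedness of the two
    rows, and [det g = W^2] gives the determinant [1]. The obstacle in the Liouville arguments is
    the zeros: the logarithm of the modulus of a holomorphic function solves the linear equation
    only away from them, and no local factorization at a zero is at hand. Each test function is
    therefore a quotient whose numerator vanishes to higher order than its denominator. It tends to
    [0] at the zeros of the denominator, which is also the value that division by zero assigns
    there, so it is continuous on the whole plane. The maximum principle then examines only points
    where the quotient is positive; near such a point it is the exponential of a solution. Growth of
    the denominator at infinity comes from convexity of [E], whose gradient map is monotone. *)

Notation dpl := differentiable_pt_lim.

Lemma dpl_eq (u : R -> R -> R) (x y a b a' b' : R) :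
  dpl u x y a b -> a = a' -> b = b' -> dpl u x y a' b'.
Proof. intros H -> ->; exact H. Qed.

Lemma dpl_affine (a b c x y : R) : dpl (fun u v => a * u + b * v + c) x y a b.
Proof.
  intros eps; exists eps; intros u v _ _.
  replace (_ - _) with 0 by ring; rewrite Rabs_R0.
  apply Rmult_le_pos; [apply Rlt_le, eps | ].
  eapply Rle_trans; [apply Rabs_pos | apply Rmax_l].
Qed.

Lemma dpl_ext (u v : R -> R -> R) (x y a b : R) :
  (forall s t, u s t = v s t) -> dpl u x y a b -> dpl v x y a b.
Proof.
  intros E; apply differentiable_pt_lim_ext.
  exists (mkposreal _ Rlt_0_1); intros; apply E.
Qed.

Lemma dpl_const (k x y : R) : dpl (fun _ _ => k) x y 0 0.
Proof.
  apply (dpl_ext (fun s t => 0 * s + 0 * t + k)); [intros; ring | apply dpl_affine].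
Qed.

Lemma dpl_fst (x y : R) : dpl (fun s _ => s) x y 1 0.
Proof. apply (dpl_ext (fun s t => 1 * s + 0 * t + 0)); [intros; ring | apply dpl_affine]. Qed.

Lemma dpl_snd (x y : R) : dpl (fun _ t => t) x y 0 1.
Proof. apply (dpl_ext (fun s t => 0 * s + 1 * t + 0)); [intros; ring | apply dpl_affine]. Qed.

Lemma dpl_Rmult (x y : R) : dpl Rmult x y y x.
Proof.
  intros eps; exists eps; intros u v Hu Hv.
  replace (_ - _) with ((u - x) * (v - y)) by ring; rewrite Rabs_mult.
  apply Rmult_le_compat; try apply Rabs_pos; [lra | apply Rmax_r].
Qed.

Lemma dpl_lincomb (p q c : R) (u v : R -> R -> R) (x y a b a' b' : R) :
  dpl u x y a b -> dpl v x y a' b' ->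
  dpl (fun s t => p * u s t + q * v s t + c) x y (p * a + q * a') (p * b + q * b').
Proof.
  intros Hu Hv.
  apply (differentiable_pt_lim_comp (fun s t => p * s + q * t + c)); auto.
  apply dpl_affine.
Qed.

Lemma dpl_mult (u v : R -> R -> R) (x y a b a' b' : R) :
  dpl u x y a b -> dpl v x y a' b' ->
  dpl (fun s t => u s t * v s t) x y
    (v x y * a + u x y * a') (v x y * b + u x y * b').
Proof.
  intros Hu Hv.
  exact (differentiable_pt_lim_comp Rmult _ _ _ _ _ _ _ _ _ _
           (dpl_Rmult _ _) Hu Hv).
Qed.

Lemma dpl_comp1 (g : R -> R) (u : R -> R -> R) (x y l a b : R) :
  is_derive g (u x y) l -> dpl u x y a b ->
  dpl (fun s t => g (u s t)) x y (l * a) (l * b).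
Proof.
  intros Hg Hu.
  eapply dpl_eq;
    [apply (differentiable_pt_lim_comp (fun s _ => g s) u (fun _ _ => 0)) | | ].
  - apply differentiable_pt_lim_proj1_0, is_derive_Reals, Hg.
  - exact Hu.
  - apply dpl_const.
  - ring.
  - ring.
Qed.

Lemma dpl_continuity (u : R -> R -> R) (x y a b : R) :
  dpl u x y a b -> continuity_2d_pt u x y.
Proof. intros H; apply differentiable_continuity_pt; now exists a, b. Qed.

Lemma dpl_line (u : R -> R -> R) (x y l1 l2 a b s : R) :
  dpl u (x + s * a) (y + s * b) l1 l2 ->
  is_derive (fun t => u (x + t * a) (y + t * b)) s (a * l1 + b * l2).
Proof.
  intros H; apply is_derive_Reals.
  replace (a * l1 + b * l2) with (l1 * a + l2 * b) by ring.
  apply (derivable_pt_lim_comp_2d u (fun t => x + t * a) (fun t => y + t * b));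
    [exact H | | ]; apply is_derive_Reals; auto_derive; auto; ring.
Qed.

Lemma dpl_of_C1 (u u1 u2 : R -> R -> R) (x y : R) :
  (forall s t, is_derive (fun z => u z t) s (u1 s t)) ->
  (forall s t, is_derive (fun z => u s z) t (u2 s t)) ->
  continuity_2d_pt u1 x y -> dpl u x y (u1 x y) (u2 x y).
Proof.
  intros H1 H2 C; apply filterdiff_differentiable_pt_lim.
  apply continuity_2d_pt_filterlim in C.
  apply (is_derive_filterdiff u x y u1 (u2 x y)); auto.
  apply filter_forall; intros; apply H1.
Qed.

(* Only one of the mixed partials enters, so both primitives are taken along
   the coordinate axes: [P(x,y) = int_0^x a(s,0) ds + int_0^y b(x,t) dt]. *)
Lemma closed_form_potential (a b a2 b1 : R -> R -> R) :
  (forall x y, continuity_2d_pt a x y) ->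
  (forall x y, continuity_2d_pt b x y) ->
  (forall x y, is_derive (fun z => a x z) y (a2 x y)) ->
  (forall x y, is_derive (fun z => b z y) x (b1 x y)) ->
  (forall x y, continuity_2d_pt b1 x y) ->
  (forall x y, a2 x y = b1 x y) ->
  exists P, P 0 0 = 0 /\ forall x y, dpl P x y (a x y) (b x y).
Proof.
  intros Ca Cb Da Db Cb1 E.
  assert (Cx : forall (h : R -> R -> R) y, (forall x y, continuity_2d_pt h x y) ->
            forall x, continuous (fun s => h s y) x).
  { intros h y Ch x; apply continuity_pt_filterlim.
    intros eps He; destruct (Ch x y (mkposreal eps He)) as [d Hd].
    exists d; split; [apply cond_pos | ]; intros z [_ Hz]; apply Hd;
      [exact Hz | rewrite Rminus_diag, Rabs_R0; apply cond_pos]. }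
  assert (Cy : forall (h : R -> R -> R) x, (forall x y, continuity_2d_pt h x y) ->
            forall y, continuous (fun s => h x s) y).
  { intros h x Ch y; apply continuity_pt_filterlim.
    intros eps He; destruct (Ch x y (mkposreal eps He)) as [d Hd].
    exists d; split; [apply cond_pos | ]; intros z [_ Hz]; apply Hd;
      [rewrite Rminus_diag, Rabs_R0; apply cond_pos | exact Hz]. }
  assert (Iy : forall x y, ex_RInt (fun t => b x t) 0 y).
  { intros; apply (@ex_RInt_continuous R_CompleteNormedModule); intros; now apply Cy. }
  exists (fun x y => RInt (fun s => a s 0) 0 x + RInt (fun t => b x t) 0 y).
  split.
  { rewrite !RInt_point; apply Rplus_0_l. }
  intros x y; apply dpl_of_C1; [ | | apply Ca]; clear x y; intros x y.
  - assert (D1 : is_derive (fun z => RInt (fun s => a s 0) 0 z) x (a x 0)).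
    { apply (is_derive_RInt (fun s => a s 0) _ 0); [ | now apply Cx].
      apply filter_forall; intros z; apply (@RInt_correct R_CompleteNormedModule).
      apply (@ex_RInt_continuous R_CompleteNormedModule); intros; now apply Cx. }
    assert (D2 : is_derive (fun z => RInt (fun t => b z t) 0 y) x
                   (RInt (fun t => Derive (fun z => b z t) x) 0 y)).
    { apply is_derive_RInt_param.
      - apply filter_forall; intros z t _; now exists (b1 z t).
      - intros t _; apply (continuity_2d_pt_ext b1); auto.
        intros; symmetry; now apply is_derive_unique.
      - apply filter_forall; intros; apply Iy. }
    (* Closedness turns the integrand into the derivative of [a] in its second variable, so the
       integral telescopes. *)
    assert (V : RInt (fun t => Derive (fun z => b z t) x) 0 y = a x y - a x 0).
    { rewrite (RInt_ext _ (fun t => a2 x t)).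
      2:{ intros t _; rewrite E; now apply is_derive_unique. }
      apply is_RInt_unique.
      apply (is_RInt_derive (fun t => a x t) (fun t => a2 x t)); intros t _; [apply Da | ].
      apply Cy; intros s r; apply (continuity_2d_pt_ext b1); auto. }
    rewrite V in D2.
    replace (a x y) with (plus (a x 0) (a x y - a x 0)) by (unfold plus; simpl; ring).
    exact (is_derive_plus _ _ _ _ _ D1 D2).
  - replace (b x y) with (plus 0 (b x y)) by (unfold plus; simpl; ring).
    apply (is_derive_plus (fun _ => RInt (fun s => a s 0) 0 x) (fun z => RInt (fun t => b x t) 0 z)).
    + apply (@is_derive_const R_AbsRing R_NormedModule).
    + apply (is_derive_RInt (fun t => b x t) _ 0); [ | now apply Cy].
      apply filter_forall; intros z; apply (@RInt_correct R_CompleteNormedModule), Iy.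
Qed.

(** * Maximum principle *)

(** The one-variable extreme value theorem is used twice: on each vertical segment, then for the
    resulting maximum [g] as a function of [x]. Writing [g] as a least upper bound avoids choosing
    maximizers; uniform continuity of [m] makes [g] continuous. *)
Lemma max_on_square (m : R -> R -> R) (r : R) :
  0 <= r -> (forall x y, continuity_2d_pt m x y) ->
  exists x0 y0, Rabs x0 <= r /\ Rabs y0 <= r /\
    forall x y, Rabs x <= r -> Rabs y <= r -> m x y <= m x0 y0.
Proof.
  intros Hr C.
  assert (Hy : forall x, exists y0, (forall y, - r <= y <= r -> m x y <= m x y0) /\
                                    - r <= y0 <= r).
  { intros x; apply (continuity_ab_maj (fun y => m x y)); [lra | ].
    intros y _ eps He; destruct (C x y (mkposreal eps He)) as [d Hd].
    exists d; split; [apply cond_pos | ]; intros z [_ Hz]; apply Hd;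
      [rewrite Rminus_diag, Rabs_R0; apply cond_pos | exact Hz]. }
  set (g x := real (Lub_Rbar (fun v => exists y, - r <= y <= r /\ v = m x y))).
  assert (Hg : forall x, exists y0, - r <= y0 <= r /\ g x = m x y0 /\
                 forall y, - r <= y <= r -> m x y <= m x y0).
  { intros x; destruct (Hy x) as [y0 [M I]]; exists y0; split; [exact I | split; [ | exact M]].
    unfold g; rewrite (is_lub_Rbar_unique _ (m x y0)); [reflexivity | split].
    - intros v [y [Iy ->]]; now apply M.
    - intros b Hb; apply Hb; eauto. }
  destruct (continuity_ab_maj g (- r) r) as [x0 [M0 I0]]; [lra | | ].
  - intros x Ix eps He.
    (* The rectangle is widened by [1] in the first variable because [z] may leave [[-r, r]]; hence
       also the [Rmin d 1] below. *)
    destruct (uniform_continuity_2d m (- (r + 1)) (r + 1) (- r) r (fun x y _ _ => C x y)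
                (mkposreal eps He)) as [d Hd]; simpl in Hd.
    exists (Rmin d 1); split.
    { apply Rmin_glb_lt; [apply cond_pos | lra]. }
    intros z [_ Hz]; simpl in *; unfold Rdist in *.
    assert (Hz1 : Rabs (z - x) < d) by (eapply Rlt_le_trans; [apply Hz | apply Rmin_l]).
    assert (Hz2 : Rabs (z - x) < 1) by (eapply Rlt_le_trans; [apply Hz | apply Rmin_r]).
    apply Rabs_def2 in Hz2.
    assert (U : forall y, - r <= y <= r -> Rabs (m z y - m x y) < eps).
    { intros y Iy; apply Hd; try lra; rewrite Rminus_diag, Rabs_R0; apply cond_pos. }
    destruct (Hg x) as [y1 [I1 [-> M1]]]; destruct (Hg z) as [y2 [I2 [-> M2]]].
    pose proof (U _ I1) as U1; pose proof (U _ I2) as U2.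
    pose proof (M1 _ I2); pose proof (M2 _ I1).
    apply Rabs_def2 in U1; apply Rabs_def2 in U2; apply Rabs_def1; lra.
  - destruct (Hg x0) as [y0 [J0 [E0 _]]].
    exists x0, y0; split; [apply Rabs_le; lra | split; [apply Rabs_le; lra | ]].
    intros x y Hx Hy'; apply Rabs_le_between in Hx; apply Rabs_le_between in Hy'.
    destruct (Hg x) as [y1 [_ [E1 M1]]].
    pose proof (M0 x Hx); pose proof (M1 y Hy'); lra.
Qed.

(** If [l > 0], then [k'] exceeds [k' 0] just to the right of [0] and stays below it just to the
    left. If [k' 0 >= 0], then [k] increases to the right; otherwise it decreases on the left
    towards [0]. The mean value theorem contradicts the maximum either way, without first showing
    [k' 0 = 0]. *)
Lemma second_derivative_at_max (k k' : R -> R) (l : R) :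
  locally 0 (fun s => is_derive k s (k' s)) -> is_derive k' 0 l ->
  locally 0 (fun s => k s <= k 0) -> l <= 0.
Proof.
  intros [d1 D1] D2 [d2 M].
  destruct (Rle_or_lt l 0) as [ | Hl]; [assumption | exfalso].
  apply is_derive_Reals in D2.
  assert (Hl2 : 0 < l / 2) by lra.
  destruct (D2 _ Hl2) as [d3 D3].
  set (d := Rmin d1 (Rmin d2 d3)).
  assert (Hd : 0 < d) by (unfold d; repeat apply Rmin_glb_lt; apply cond_pos).
  assert (Hd1 : d <= d1) by apply Rmin_l.
  assert (Hd2 : d <= d2) by (eapply Rle_trans; [apply Rmin_r | apply Rmin_l]).
  assert (Hd3 : d <= d3) by (eapply Rle_trans; [apply Rmin_r | apply Rmin_r]).
  assert (Q : forall s, s <> 0 -> Rabs s < d -> l / 2 < (k' s - k' 0) / s).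
  { intros s Hs Hsd; specialize (D3 s Hs (Rlt_le_trans _ _ _ Hsd Hd3)).
    rewrite Rplus_0_l in D3; apply Rabs_def2 in D3; lra. }
  assert (Dk : forall s, Rabs s < d -> derivable_pt_lim k s (k' s)).
  { intros s Hs; apply is_derive_Reals, D1; unfold ball; simpl; unfold AbsRing_ball, abs,
      minus, plus, opp; simpl; rewrite Ropp_0, Rplus_0_r; lra. }
  assert (Mk : forall s, Rabs s < d -> k s <= k 0).
  { intros s Hs; apply M; unfold ball; simpl; unfold AbsRing_ball, abs,
      minus, plus, opp; simpl; rewrite Ropp_0, Rplus_0_r; lra. }
  destruct (Rle_or_lt 0 (k' 0)) as [H0 | H0].
  - destruct (MVT_cor2 k k' 0 (d / 2)) as [c [Ec Ic]]; [lra | | ].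
    { intros c Ic; apply Dk, Rabs_def1; lra. }
    assert (Hc : Rabs c < d) by (apply Rabs_def1; lra).
    assert (Hm : k (d / 2) <= k 0) by (apply Mk, Rabs_def1; lra).
    assert (Qc : l / 2 < (k' c - k' 0) / c) by (apply Q; [lra | exact Hc]).
    assert (Pc : 0 < (k' c - k' 0) / c * c) by (apply Rmult_lt_0_compat; lra).
    replace ((k' c - k' 0) / c * c) with (k' c - k' 0) in Pc by (field; lra).
    assert (0 < k' c * (d / 2 - 0)) by (apply Rmult_lt_0_compat; lra).
    lra.
  - destruct (MVT_cor2 k k' (- (d / 2)) 0) as [c [Ec Ic]]; [lra | | ].
    { intros c Ic; apply Dk, Rabs_def1; lra. }
    assert (Hc : Rabs c < d) by (apply Rabs_def1; lra).
    assert (Hm : k (- (d / 2)) <= k 0) by (apply Mk, Rabs_def1; lra).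
    assert (Qc : l / 2 < (k' c - k' 0) / c) by (apply Q; [lra | exact Hc]).
    assert (Pc : 0 < (k' c - k' 0) / c * - c) by (apply Rmult_lt_0_compat; lra).
    replace ((k' c - k' 0) / c * - c) with (- (k' c - k' 0)) in Pc by (field; lra).
    assert (0 < - k' c * (0 - - (d / 2))) by (apply Rmult_lt_0_compat; lra).
    lra.
Qed.

(* A pointwise form of [c11 phi_xx + 2 c12 phi_xy + c22 phi_yy = v] that only
   looks at [phi] along lines through [(x, y)]. *)
Definition second_order_op (c11 c12 c22 : R) (phi : R -> R -> R) (x y v : R) : Prop :=
  exists h11 h12 h22,
    (forall a b, exists k',
       locally 0 (fun s => is_derive (fun t => phi (x + t * a) (y + t * b)) s (k' s)) /\
       is_derive k' 0 (a * a * h11 + 2 * a * b * h12 + b * b * h22)) /\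
    c11 * h11 + 2 * c12 * h12 + c22 * h22 = v.

Lemma second_order_op_lincomb (c11 c12 c22 p q : R) (phi psi : R -> R -> R)
    (x y v w : R) :
  second_order_op c11 c12 c22 phi x y v -> second_order_op c11 c12 c22 psi x y w ->
  second_order_op c11 c12 c22 (fun s t => p * phi s t + q * psi s t) x y
    (p * v + q * w).
Proof.
  intros (h11 & h12 & h22 & H & E) (g11 & g12 & g22 & G & F).
  exists (p * h11 + q * g11), (p * h12 + q * g12), (p * h22 + q * g22).
  split; [ | rewrite <- E, <- F; ring].
  intros a b; destruct (H a b) as [k [K1 K2]]; destruct (G a b) as [j [J1 J2]].
  exists (fun s => p * k s + q * j s); split.
  - eapply filter_imp; [ | apply (filter_and _ _ K1 J1)]; intros s [Ks Js].
    apply (is_derive_plus (fun t => p * phi (x + t * a) (y + t * b))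
             (fun t => q * psi (x + t * a) (y + t * b))); now apply (is_derive_scal _ s).
  - replace (_ + _) with
      (plus (p * (a * a * h11 + 2 * a * b * h12 + b * b * h22))
            (q * (a * a * g11 + 2 * a * b * g12 + b * b * g22)))
      by (unfold plus; simpl; ring).
    apply (is_derive_plus (fun t => p * k t) (fun t => q * j t)); now apply is_derive_scal.
Qed.

Lemma second_order_op_sqnorm (c11 c12 c22 x y : R) :
  second_order_op c11 c12 c22 (fun s t => s * s + t * t) x y (2 * c11 + 2 * c22).
Proof.
  exists 2, 0, 2; split; [ | ring].
  intros a b; exists (fun s => 2 * a * (x + s * a) + 2 * b * (y + s * b)); split.
  - apply filter_forall; intros s; auto_derive; auto; ring.
  - auto_derive; auto; ring.
Qed.

Lemma second_order_op_at_max (c11 c12 c22 : R) (phi : R -> R -> R) (x y v : R) :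
  0 < c11 -> 0 < c11 * c22 - c12 * c12 ->
  second_order_op c11 c12 c22 phi x y v ->
  locally_2d (fun s t => phi s t <= phi x y) x y -> v <= 0.
Proof.
  intros P1 P2 (h11 & h12 & h22 & H & <-) [d M].
  assert (T : forall a b, a * a * h11 + 2 * a * b * h12 + b * b * h22 <= 0).
  { intros a b; destruct (H a b) as [k [K1 K2]].
    apply (second_derivative_at_max _ _ _ K1 K2).
    set (e := d / (Rabs a + Rabs b + 1)).
    assert (Ha := Rabs_pos a); assert (Hb := Rabs_pos b).
    assert (He : 0 < e) by (apply Rdiv_lt_0_compat; [apply cond_pos | lra]).
    assert (Ee : e * (Rabs a + Rabs b + 1) = d) by (unfold e; field; lra).
    exists (mkposreal e He); intros s Hs.
    unfold ball in Hs; simpl in Hs; unfold AbsRing_ball, abs, minus, plus, opp in Hs;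
      simpl in Hs; rewrite Ropp_0, Rplus_0_r in Hs.
    rewrite !Rmult_0_l, !Rplus_0_r.
    assert (B1 := Rmult_le_compat_r (Rabs a) _ _ Ha (Rlt_le _ _ Hs)).
    assert (B2 := Rmult_le_compat_r (Rabs b) _ _ Hb (Rlt_le _ _ Hs)).
    assert (0 <= e * Rabs a) by (apply Rmult_le_pos; lra).
    assert (0 <= e * Rabs b) by (apply Rmult_le_pos; lra).
    apply M.
    - replace (x + s * a - x) with (s * a) by ring; rewrite Rabs_mult; nra.
    - replace (y + s * b - y) with (s * b) by ring; rewrite Rabs_mult; nra. }
  (* Completing the square: [c11] times the operator is the second derivative along [(c11, c12)]
     plus the determinant times the one along [(0, 1)]. *)
  assert (T1 := T c11 c12); assert (T2 := T 0 1).
  apply (Rmult_le_reg_l c11); [assumption | rewrite Rmult_0_r].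
  replace (c11 * (c11 * h11 + 2 * c12 * h12 + c22 * h22)) with
    (c11 * c11 * h11 + 2 * c11 * c12 * h12 + c12 * c12 * h22
     + (c11 * c22 - c12 * c12) * h22) by ring.
  assert ((c11 * c22 - c12 * c12) * h22 <= 0) by nra.
  lra.
Qed.

(* A maximum of [m * exp (eps * (x^2 + y^2))] with [m] positive cannot be
   interior, as the exponent of [m] is annihilated by the operator. *)
Lemma maximum_principle (c11 c12 c22 m : R -> R -> R) (r B : R) :
  (forall x y, 0 < c11 x y /\ 0 < c22 x y /\ 0 < c11 x y * c22 x y - c12 x y * c12 x y) ->
  0 <= r -> 0 < B ->
  (forall x y, continuity_2d_pt m x y) ->
  (forall x y, 0 < m x y -> exists phi,
     second_order_op (c11 x y) (c12 x y) (c22 x y) phi x y 0 /\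
     locally_2d (fun s t => m s t = exp (phi s t)) x y) ->
  (forall x y, Rabs x <= r -> Rabs y <= r -> Rabs x = r \/ Rabs y = r -> m x y <= B) ->
  forall x y, Rabs x <= r -> Rabs y <= r -> m x y <= B.
Proof.
  intros Hc Hr HB Cm Hm Hbd x y Hx Hy.
  destruct (Rle_or_lt (m x y) B) as [ | Hlt]; [assumption | exfalso].
  assert (Hln : 0 < ln (m x y / B)).
  { rewrite <- ln_1; apply ln_increasing; [lra | ].
    apply (Rmult_lt_reg_r B); [lra | ]; replace (m x y / B * B) with (m x y) by (field; lra); lra. }
  (* On the square [x^2 + y^2 <= 2 r^2], so with this [eps] the perturbed function stays below
     [m x y] on the boundary; the [+ 1] covers [r = 0]. *)
  set (eps := ln (m x y / B) / (4 * (r * r + 1))).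
  assert (Hrr : 0 <= r * r) by (apply Rmult_le_pos; lra).
  assert (Heps : 0 < eps) by (apply Rdiv_lt_0_compat; lra).
  assert (Hexp : B * exp (eps * (2 * (r * r))) < m x y).
  { replace (m x y) with (B * (m x y / B)) by (field; lra).
    apply Rmult_lt_compat_l; [lra | ].
    rewrite <- (exp_ln (m x y / B)) at 1; [ | apply Rdiv_lt_0_compat; lra].
    apply exp_increasing.
    apply Rlt_le_trans with (eps * (4 * (r * r + 1))).
    - apply Rmult_lt_compat_l; lra.
    - unfold eps; right; field; lra. }
  set (sq := fun s t : R => s * s + t * t).
  destruct (max_on_square (fun s t => m s t * exp (eps * sq s t)) r Hr)
    as (x0 & y0 & I0 & J0 & M0).
  { intros s t; apply continuity_2d_pt_mult; [apply Cm | ].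
    apply (continuity_1d_2d_pt_comp (fun z => exp (eps * z)) sq).
    - apply derivable_continuous_pt; eexists; apply is_derive_Reals; auto_derive; auto.
    - apply continuity_2d_pt_plus; apply continuity_2d_pt_mult;
        first [apply continuity_2d_pt_id1 | apply continuity_2d_pt_id2]. }
  assert (Sq : forall s t, 0 <= sq s t) by (intros; unfold sq; nra).
  assert (Mx : m x y <= m x0 y0 * exp (eps * sq x0 y0)).
  { eapply Rle_trans; [ | apply (M0 x y Hx Hy)].
    rewrite <- (Rmult_1_r (m x y)) at 1; apply Rmult_le_compat_l; [lra | ].
    rewrite <- exp_0; destruct (Req_dec (sq x y) 0) as [-> | N].
    - rewrite Rmult_0_r; lra.
    - left; apply exp_increasing, Rmult_lt_0_compat; [assumption | specialize (Sq x y); lra]. }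
  assert (Ex := exp_pos (eps * sq x0 y0)).
  assert (Pm : 0 < m x0 y0).
  { apply (Rmult_lt_reg_r (exp (eps * sq x0 y0))); lra. }
  assert (In : Rabs x0 < r /\ Rabs y0 < r).
  { destruct (Rlt_or_le (Rabs x0) r), (Rlt_or_le (Rabs y0) r); try (split; assumption);
      exfalso;
      (assert (Bm : m x0 y0 <= B) by (apply Hbd; auto; lra));
      (assert (exp (eps * sq x0 y0) <= exp (eps * (2 * (r * r)))));
      try nra;
      (assert (sq x0 y0 <= 2 * (r * r)) by
         (unfold sq; apply Rabs_le_between in I0; apply Rabs_le_between in J0; nra));
      (destruct (Req_dec (sq x0 y0) (2 * (r * r))) as [-> | ]; [lra | ]);
      left; apply exp_increasing; nra. }
  destruct In as [Ix Iy].
  destruct (Hm x0 y0 Pm) as [phi [Lphi [d Hd]]].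
  destruct (Hc x0 y0) as (C1 & C2 & C3).
  assert (N : 1 * 0 + eps * (2 * c11 x0 y0 + 2 * c22 x0 y0) <= 0).
  { eapply (second_order_op_at_max _ _ _ (fun s t => 1 * phi s t + eps * sq s t) x0 y0);
      [exact C1 | exact C3 | | ].
    - apply second_order_op_lincomb; [exact Lphi | apply second_order_op_sqnorm].
    - assert (Hd' : 0 < Rmin d (Rmin (r - Rabs x0) (r - Rabs y0))).
      { repeat apply Rmin_glb_lt; [apply cond_pos | lra | lra]. }
      exists (mkposreal _ Hd'); simpl; intros s t Hs Ht.
      assert (L1 := Rmin_l d (Rmin (r - Rabs x0) (r - Rabs y0))).
      assert (L2 := Rmin_r d (Rmin (r - Rabs x0) (r - Rabs y0))).
      assert (L3 := Rmin_l (r - Rabs x0) (r - Rabs y0)).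
      assert (L4 := Rmin_r (r - Rabs x0) (r - Rabs y0)).
      assert (Rs : Rabs s <= r).
      { replace s with ((s - x0) + x0) by ring.
        eapply Rle_trans; [apply Rabs_triang | lra]. }
      assert (Rt : Rabs t <= r).
      { replace t with ((t - y0) + y0) by ring.
        eapply Rle_trans; [apply Rabs_triang | lra]. }
      specialize (M0 s t Rs Rt); cbn beta in M0.
      rewrite (Hd s t), (Hd x0 y0), <- !exp_plus in M0; try lra;
        try (rewrite Rminus_diag, Rabs_R0; apply cond_pos).
      rewrite !Rmult_1_l.
      destruct (Rle_or_lt (phi s t + eps * sq s t) (phi x0 y0 + eps * sq x0 y0))
        as [ | G]; [assumption | apply exp_increasing in G; lra]. }
  assert (0 < eps * (2 * c11 x0 y0 + 2 * c22 x0 y0)) by (apply Rmult_lt_0_compat; lra).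
  lra.
Qed.

(** * Holomorphic pairs *)

(* [u + i v] is holomorphic for the conformal structure of a metric [A] with
   [det A = 1]: the conditions on [v1, v2] are the Cauchy-Riemann system
   [dv = * du], and [A22 d11 - 2 A12 d12 + A11 d22] is the Laplacian of [A] when
   the coordinate functions are harmonic. *)
Definition hol (A11 A12 A22 u v : R -> R -> R) : Prop :=
  exists u1 u2 v1 v2 : R -> R -> R, forall x y,
    dpl u x y (u1 x y) (u2 x y) /\
    dpl v x y (v1 x y) (v2 x y) /\
    v1 x y = A12 x y * u1 x y - A11 x y * u2 x y /\
    v2 x y = A22 x y * u1 x y - A12 x y * u2 x y /\
    (exists h11 h12 h22, dpl u1 x y h11 h12 /\ dpl u2 x y h12 h22 /\
       A22 x y * h11 - 2 * A12 x y * h12 + A11 x y * h22 = 0) /\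
    (exists h11 h12 h22, dpl v1 x y h11 h12 /\ dpl v2 x y h12 h22 /\
       A22 x y * h11 - 2 * A12 x y * h12 + A11 x y * h22 = 0).

Definition unimodular (A11 A12 A22 : R -> R -> R) : Prop :=
  forall x y, 0 < A11 x y /\ A11 x y * A22 x y - A12 x y * A12 x y = 1.

Definition sqn (u v : R -> R -> R) (x y : R) : R := u x y * u x y + v x y * v x y.

(* [a (u + i v) + b (u' + i v') + c] with complex [a, b, c]. *)
Lemma hol_lincomb (A11 A12 A22 u v u' v' : R -> R -> R) (a1 a2 b1 b2 c1 c2 : R) :
  unimodular A11 A12 A22 ->
  hol A11 A12 A22 u v -> hol A11 A12 A22 u' v' ->
  hol A11 A12 A22
    (fun x y => a1 * u x y - a2 * v x y + (b1 * u' x y - b2 * v' x y) + c1)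
    (fun x y => a1 * v x y + a2 * u x y + (b1 * v' x y + b2 * u' x y) + c2).
Proof.
  intros UA (u1 & u2 & v1 & v2 & H) (p1 & p2 & q1 & q2 & G).
  assert (D : forall (a b c d e : R) (f g h k : R -> R -> R) x y fx fy gx gy hx hy kx ky,
    dpl f x y fx fy -> dpl g x y gx gy -> dpl h x y hx hy -> dpl k x y kx ky ->
    dpl (fun s t => a * f s t + b * g s t + (c * h s t + d * k s t) + e) x y
      (a * fx + b * gx + (c * hx + d * kx)) (a * fy + b * gy + (c * hy + d * ky))).
  { intros a b c d e f g h k x y fx fy gx gy hx hy kx ky F1 F2 F3 F4.
    apply (dpl_ext (fun s t => 1 * (a * f s t + b * g s t + 0)
             + 1 * (c * h s t + d * k s t + 0) + e)); [intros; ring | ].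
    eapply dpl_eq; [apply dpl_lincomb; apply dpl_lincomb; eassumption | ring | ring]. }
  exists (fun x y => a1 * u1 x y + - a2 * v1 x y + (b1 * p1 x y + - b2 * q1 x y) + 0),
         (fun x y => a1 * u2 x y + - a2 * v2 x y + (b1 * p2 x y + - b2 * q2 x y) + 0),
         (fun x y => a1 * v1 x y + a2 * u1 x y + (b1 * q1 x y + b2 * p1 x y) + 0),
         (fun x y => a1 * v2 x y + a2 * u2 x y + (b1 * q2 x y + b2 * p2 x y) + 0).
  intros x y.
  destruct (H x y) as (U & V & E1 & E2 & (h11 & h12 & h22 & H1 & H2 & H3)
                       & (k11 & k12 & k22 & K1 & K2 & K3)).
  destruct (G x y) as (U' & V' & E1' & E2' & (g11 & g12 & g22 & G1 & G2 & G3)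
                       & (j11 & j12 & j22 & J1 & J2 & J3)).
  destruct (UA x y) as [_ Edet].
  split; [ | split; [ | split; [ | split; [ | split]]]].
  - eapply dpl_eq; [eapply (dpl_ext (fun s t => a1 * u s t + - a2 * v s t
        + (b1 * u' s t + - b2 * v' s t) + c1)); [intros; ring | apply D; eassumption] | ring | ring].
  - eapply dpl_eq; [eapply (dpl_ext (fun s t => a1 * v s t + a2 * u s t
        + (b1 * v' s t + b2 * u' s t) + c2)); [intros; ring | apply D; eassumption] | ring | ring].
  (* Multiplication by [i] respects the Cauchy-Riemann system because the star operator squares to
     [-1]; this is where [det A = 1] enters. *)
  - rewrite E1, E1', E2, E2'; apply Rminus_diag_uniq.
    transitivity ((1 - (A11 x y * A22 x y - A12 x y * A12 x y))
                  * (a2 * u1 x y + b2 * p1 x y)); [ring | rewrite Edet; ring].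
  - rewrite E1, E1', E2, E2'; apply Rminus_diag_uniq.
    transitivity ((1 - (A11 x y * A22 x y - A12 x y * A12 x y))
                  * (a2 * u2 x y + b2 * p2 x y)); [ring | rewrite Edet; ring].
  - do 3 eexists; split; [apply D; eassumption | split; [apply D; eassumption | ]].
    transitivity (a1 * (A22 x y * h11 - 2 * A12 x y * h12 + A11 x y * h22)
      - a2 * (A22 x y * k11 - 2 * A12 x y * k12 + A11 x y * k22)
      + b1 * (A22 x y * g11 - 2 * A12 x y * g12 + A11 x y * g22)
      - b2 * (A22 x y * j11 - 2 * A12 x y * j12 + A11 x y * j22)); [ring | ].
    rewrite H3, K3, G3, J3; ring.
  - do 3 eexists; split; [apply D; eassumption | split; [apply D; eassumption | ]].
    transitivity (a2 * (A22 x y * h11 - 2 * A12 x y * h12 + A11 x y * h22)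
      + a1 * (A22 x y * k11 - 2 * A12 x y * k12 + A11 x y * k22)
      + b2 * (A22 x y * g11 - 2 * A12 x y * g12 + A11 x y * g22)
      + b1 * (A22 x y * j11 - 2 * A12 x y * j12 + A11 x y * j22)); [ring | ].
    rewrite H3, K3, G3, J3; ring.
Qed.

Lemma Derive_eta (f : R -> R) (x l : R) :
  is_derive f x l -> Derive (fun t : R => f t) x = l.
Proof. exact (is_derive_unique f x l). Qed.

Lemma ln_sqn_line (n1 n2 n1' n2' : R -> R) (l1 l2 : R) :
  (forall s, is_derive n1 s (n1' s)) -> (forall s, is_derive n2 s (n2' s)) ->
  is_derive n1' 0 l1 -> is_derive n2' 0 l2 ->
  0 < n1 0 * n1 0 + n2 0 * n2 0 ->
  exists k', locally 0 (fun s => is_derive (fun t => ln (n1 t * n1 t + n2 t * n2 t)) s (k' s)) /\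
    is_derive k' 0
      (2 * (n1' 0 * n1' 0 + n2' 0 * n2' 0 + n1 0 * l1 + n2 0 * l2)
         / (n1 0 * n1 0 + n2 0 * n2 0)
       - 4 * ((n1 0 * n1' 0 + n2 0 * n2' 0) * (n1 0 * n1' 0 + n2 0 * n2' 0))
         / ((n1 0 * n1 0 + n2 0 * n2 0) * (n1 0 * n1 0 + n2 0 * n2 0))).
Proof.
  intros D1 D2 E1 E2 P.
  exists (fun s => 2 * (n1 s * n1' s + n2 s * n2' s) / (n1 s * n1 s + n2 s * n2 s)).
  split.
  - assert (L : locally 0 (fun s => 0 < n1 s * n1 s + n2 s * n2 s)).
    { assert (C : continuous (fun s => n1 s * n1 s + n2 s * n2 s) 0).
      { apply (ex_derive_continuous (fun s => n1 s * n1 s + n2 s * n2 s)).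
        auto_derive; repeat split; eexists; eauto. }
      apply (C (fun z => 0 < z)), (open_gt 0), P. }
    eapply filter_imp; [ | exact L]; intros s Ps; cbn beta in Ps.
    auto_derive; [repeat split; first [eexists; eauto | lra] | ].
    rewrite (Derive_eta _ _ _ (D1 s)), (Derive_eta _ _ _ (D2 s)).
    field; lra.
  - auto_derive; [repeat split; first [eexists; eauto | lra] | ].
    rewrite (Derive_eta _ _ _ (D1 0)), (Derive_eta _ _ _ (D2 0)), (Derive_eta _ _ _ E1),
      (Derive_eta _ _ _ E2).
    field; lra.
Qed.

(** The coefficients are those of the inverse of [A]. By the Cauchy-Riemann system the gradients of
    [u] and [v] are orthogonal for it and have the same squared length [kap]. The first-order terms
    then contribute [4 kap / r] and [- 4 kap / r], and the second-order terms vanish as [u] and [v]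
    are harmonic. *)
Lemma hol_ln_sqn (A11 A12 A22 u v : R -> R -> R) (x y : R) :
  unimodular A11 A12 A22 -> hol A11 A12 A22 u v -> 0 < sqn u v x y ->
  second_order_op (A22 x y) (- A12 x y) (A11 x y)
    (fun s t => ln (sqn u v s t)) x y 0.
Proof.
  intros UA (u1 & u2 & v1 & v2 & H) P; destruct (UA x y) as [_ Edet].
  destruct (H x y) as (_ & _ & E1 & E2 & (h11 & h12 & h22 & H1 & H2 & H3)
                       & (k11 & k12 & k22 & K1 & K2 & K3)).
  set (r := sqn u v x y) in *; set (U := u x y) in *; set (V := v x y) in *.
  set (a1 := u1 x y) in *; set (a2 := u2 x y) in *.
  set (b1 := v1 x y) in *; set (b2 := v2 x y) in *.
  exists (2 * (a1 * a1 + b1 * b1 + U * h11 + V * k11) / r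
          - 4 * ((U * a1 + V * b1) * (U * a1 + V * b1)) / (r * r)),
         (2 * (a1 * a2 + b1 * b2 + U * h12 + V * k12) / r
          - 4 * ((U * a1 + V * b1) * (U * a2 + V * b2)) / (r * r)),
         (2 * (a2 * a2 + b2 * b2 + U * h22 + V * k22) / r
          - 4 * ((U * a2 + V * b2) * (U * a2 + V * b2)) / (r * r)).
  split.
  - intros a b.
    assert (DL : forall (w w1 w2 : R -> R -> R),
      (forall s t, dpl w s t (w1 s t) (w2 s t)) ->
      forall s, is_derive (fun t => w (x + t * a) (y + t * b)) s
        (a * w1 (x + s * a) (y + s * b) + b * w2 (x + s * a) (y + s * b))).
    { intros w w1 w2 Hw s; apply dpl_line, Hw. }
    assert (DL2 : forall (w1 w2 : R -> R -> R) g11 g12 g22,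
      dpl w1 x y g11 g12 -> dpl w2 x y g12 g22 ->
      is_derive (fun s => a * w1 (x + s * a) (y + s * b) + b * w2 (x + s * a) (y + s * b)) 0
        (a * (a * g11 + b * g12) + b * (a * g12 + b * g22))).
    { intros w1 w2 g11 g12 g22 G1 G2.
      assert (Ex : x = x + 0 * a) by ring; assert (Ey : y = y + 0 * b) by ring.
      rewrite Ex, Ey in G1, G2.
      apply (is_derive_plus (fun s => a * w1 (x + s * a) (y + s * b))
               (fun s => b * w2 (x + s * a) (y + s * b)));
        apply (is_derive_scal _ 0); now apply dpl_line. }
    destruct (ln_sqn_line _ _ _ _ _ _
       (DL u u1 u2 (fun s t => proj1 (H s t)))
       (DL v v1 v2 (fun s t => proj1 (proj2 (H s t))))
       (DL2 u1 u2 _ _ _ H1 H2) (DL2 v1 v2 _ _ _ K1 K2)) as [k [Q1 Q2]].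
    { rewrite !Rmult_0_l, !Rplus_0_r; exact P. }
    exists k; split; [exact Q1 | ].
    eapply is_derive_ext_loc; [apply filter_forall; intros; reflexivity | ].
    rewrite !Rmult_0_l, !Rplus_0_r in Q2; fold U V a1 a2 b1 b2 in Q2.
    change (U * U + V * V) with r in Q2.
    match type of Q2 with is_derive _ _ ?l => match goal with |- is_derive _ _ ?l' =>
      replace l' with l; [exact Q2 | field; lra] end end.
  - assert (Er : U * U + V * V = r) by reflexivity.
    set (kap := A22 x y * (a1 * a1) - 2 * A12 x y * (a1 * a2) + A11 x y * (a2 * a2)).
    set (p := A11 x y) in *; set (q := A12 x y) in *; set (w := A22 x y) in *.
    assert (Kv : w * (b1 * b1) - 2 * q * (b1 * b2) + p * (b2 * b2) = kap).
    { rewrite E1, E2; transitivity ((p * w - q * q) * kap); [unfold kap; ring | rewrite Edet; ring]. }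
    assert (Kuv : w * (a1 * b1) - q * (a1 * b2 + a2 * b1) + p * (a2 * b2) = 0).
    { rewrite E1, E2; ring. }
    transitivity (2 / r * (kap
        + (w * (b1 * b1) - 2 * q * (b1 * b2) + p * (b2 * b2))
        + U * (w * h11 - 2 * q * h12 + p * h22) + V * (w * k11 - 2 * q * k12 + p * k22))
      - 4 / (r * r) * (U * U * kap
        + V * V * (w * (b1 * b1) - 2 * q * (b1 * b2) + p * (b2 * b2))
        + 2 * U * V * (w * (a1 * b1) - q * (a1 * b2 + a2 * b1) + p * (a2 * b2)))).
    { unfold kap; field; lra. }
    rewrite Kv, Kuv, H3, K3.
    replace (U * U * kap + V * V * kap + 2 * U * V * 0) with ((U * U + V * V) * kap) by ring.
    rewrite Er; field; lra.
Qed.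

(** * Liouville's theorem *)

Lemma hol_ext (A11 A12 A22 u v u' v' : R -> R -> R) :
  (forall x y, u x y = u' x y) -> (forall x y, v x y = v' x y) ->
  hol A11 A12 A22 u v -> hol A11 A12 A22 u' v'.
Proof.
  intros Eu Ev (u1 & u2 & v1 & v2 & H); exists u1, u2, v1, v2; intros x y.
  destruct (H x y) as (U & V & R); split; [ | split; [ | exact R]].
  - exact (dpl_ext _ _ _ _ _ _ Eu U).
  - exact (dpl_ext _ _ _ _ _ _ Ev V).
Qed.

Lemma hol_shift (A11 A12 A22 u v : R -> R -> R) (c1 c2 : R) :
  unimodular A11 A12 A22 -> hol A11 A12 A22 u v ->
  hol A11 A12 A22 (fun x y => u x y + c1) (fun x y => v x y + c2).
Proof.
  intros UA H.
  eapply hol_ext; [ | | exact (hol_lincomb _ _ _ _ _ _ _ 1 0 0 0 c1 c2 UA H H)];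
    intros; simpl; ring.
Qed.

Lemma hol_sqn_continuity (A11 A12 A22 u v : R -> R -> R) (x y : R) :
  hol A11 A12 A22 u v -> continuity_2d_pt (sqn u v) x y.
Proof.
  intros (u1 & u2 & v1 & v2 & H); destruct (H x y) as (U & V & _).
  apply dpl_continuity in U; apply dpl_continuity in V.
  apply continuity_2d_pt_plus; now apply continuity_2d_pt_mult.
Qed.

Lemma sqn_nonneg (u v : R -> R -> R) (x y : R) : 0 <= sqn u v x y.
Proof. apply Rplus_le_le_0_compat; apply Rle_0_sqr. Qed.

Lemma sqn_eq0 (u v : R -> R -> R) (x y : R) : sqn u v x y = 0 -> u x y = 0 /\ v x y = 0.
Proof. exact (Rplus_sqr_eq_0 _ _). Qed.

Lemma continuity_2d_pt_pos (u : R -> R -> R) (x y : R) :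
  continuity_2d_pt u x y -> 0 < u x y -> locally_2d (fun s t => 0 < u s t) x y.
Proof.
  intros C P; destruct (C (mkposreal _ P)) as [d Hd]; exists d; intros s t Hs Ht.
  specialize (Hd s t Hs Ht); apply Rabs_def2 in Hd; simpl in Hd; lra.
Qed.

Lemma continuity_2d_pt_squeeze (m h : R -> R -> R) (x y : R) :
  locally_2d (fun s t => 0 <= m s t <= h s t) x y ->
  continuity_2d_pt h x y -> h x y = 0 -> continuity_2d_pt m x y.
Proof.
  intros L C E eps.
  assert (M := locally_2d_singleton _ _ _ L); simpl in M.
  eapply locally_2d_impl; [ | exact (locally_2d_and _ _ _ _ L (C eps))].
  apply locally_2d_forall; intros s t [I J].
  apply Rabs_def2 in J; apply Rabs_def1; lra.
Qed.

(** Provides the order of vanishing in [liouville]: a squared increment is bounded by the squared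
    distance. *)
Lemma dpl_sq_lipschitz (u : R -> R -> R) (x y a b : R) :
  dpl u x y a b -> exists C, 0 <= C /\
    locally_2d (fun s t => (u s t - u x y) * (u s t - u x y)
                  <= C * ((s - x) * (s - x) + (t - y) * (t - y))) x y.
Proof.
  intros D; set (L := Rabs a + Rabs b + 1).
  assert (Ha := Rabs_pos a); assert (Hb := Rabs_pos b).
  exists (L * L); split; [apply Rle_0_sqr | ].
  eapply locally_2d_impl; [ | exact (D (mkposreal _ Rlt_0_1))].
  apply locally_2d_forall; intros s t H; simpl in H.
  set (M := Rmax (Rabs (s - x)) (Rabs (t - y))) in *.
  assert (M1 : Rabs (s - x) <= M) by apply Rmax_l.
  assert (M2 : Rabs (t - y) <= M) by apply Rmax_r.
  assert (M0 : 0 <= M) by (eapply Rle_trans; [apply Rabs_pos | exact M1]).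
  assert (B : Rabs (u s t - u x y) <= L * M).
  { replace (u s t - u x y) with
      ((u s t - u x y - (a * (s - x) + b * (t - y))) + (a * (s - x) + b * (t - y))) by ring.
    eapply Rle_trans; [apply Rabs_triang | ].
    eapply Rle_trans; [apply Rplus_le_compat; [exact H | apply Rabs_triang] | ].
    rewrite !Rabs_mult; unfold L; nra. }
  assert (MM : M * M <= (s - x) * (s - x) + (t - y) * (t - y)).
  { assert (S1 := Rsqr_abs (s - x)); assert (S2 := Rsqr_abs (t - y)); unfold Rsqr in *.
    assert (Q1 := Rle_0_sqr (s - x)); assert (Q2 := Rle_0_sqr (t - y)); unfold Rsqr in *.
    unfold M, Rmax; destruct (Rle_dec _ _); lra. }
  assert (S := Rsqr_abs (u s t - u x y)); unfold Rsqr in S; rewrite S.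
  assert (P := Rabs_pos (u s t - u x y)).
  apply Rle_trans with ((L * M) * (L * M)); [now apply Rmult_le_compat | ].
  replace (L * M * (L * M)) with (L * L * (M * M)) by ring.
  apply Rmult_le_compat_l; [apply Rle_0_sqr | exact MM].
Qed.

Lemma decaying_nonpositive (c11 c12 c22 m : R -> R -> R) (x0 y0 K : R) :
  (forall x y, 0 < c11 x y /\ 0 < c22 x y /\ 0 < c11 x y * c22 x y - c12 x y * c12 x y) ->
  (forall x y, continuity_2d_pt m x y) ->
  (forall x y, 0 < m x y -> exists phi,
     second_order_op (c11 x y) (c12 x y) (c22 x y) phi x y 0 /\
     locally_2d (fun s t => m s t = exp (phi s t)) x y) ->
  (forall x y, m x y * ((x - x0) * (x - x0) + (y - y0) * (y - y0)) <= K) ->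
  forall x y, m x y <= 0.
Proof.
  intros Hc Cm Hm Hd x y.
  destruct (Rle_or_lt (m x y) 0) as [ | P]; [assumption | exfalso].
  assert (HK : 0 <= K).
  { eapply Rle_trans; [ | apply (Hd x y)]. apply Rmult_le_pos; [lra | ].
    apply Rplus_le_le_0_compat; apply Rle_0_sqr. }
  set (B := m x y / 2); assert (HB : 0 < B) by (unfold B; lra).
  (* At distance at least [q >= 1] from the base point the squared distance is also at least [q],
     and [q B = K + B > K] rules out values above [B] there. With [B] half of [m x y], the maximum
     principle gives the contradiction. *)
  set (q := K / B + 1).
  assert (Hq : 1 <= q).
  { unfold q; assert (0 <= K / B) by (apply Rle_mult_inv_pos; lra); lra. }
  assert (HqB : q * B = K + B) by (unfold q; field; lra).
  assert (X0 := Rabs_pos x0); assert (Y0 := Rabs_pos y0).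
  assert (X := Rabs_pos x); assert (Y := Rabs_pos y).
  set (r := Rabs x0 + Rabs y0 + Rabs x + Rabs y + q).
  assert (M : m x y <= B).
  { apply (maximum_principle c11 c12 c22 m r B); auto; try (unfold r; lra).
    intros s t _ _ Hst.
    destruct (Rle_or_lt (m s t) B) as [ | G]; [assumption | exfalso].
    assert (D : q <= (s - x0) * (s - x0) + (t - y0) * (t - y0)).
    { assert (S1 := Rsqr_abs (s - x0)); assert (S2 := Rsqr_abs (t - y0)); unfold Rsqr in *.
      assert (T1 := Rabs_triang_inv s x0); assert (T2 := Rabs_triang_inv t y0).
      destruct Hst as [E | E]; rewrite E in *; unfold r in *.
      - assert (q <= Rabs (s - x0)) by lra; assert (0 <= (t - y0) * (t - y0)) by nra; nra.
      - assert (q <= Rabs (t - y0)) by lra; assert (0 <= (s - x0) * (s - x0)) by nra; nra. }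
    specialize (Hd s t); nra. }
  unfold B in M; lra.
Qed.

Lemma unimodular_elliptic (A11 A12 A22 : R -> R -> R) : unimodular A11 A12 A22 ->
  forall x y, 0 < A22 x y /\ 0 < A11 x y /\
    0 < A22 x y * A11 x y - (- A12 x y) * (- A12 x y).
Proof.
  intros UA x y; destruct (UA x y) as [P D].
  split; [ | split; [exact P | lra]]; nra.
Qed.

(** Takes the place of a global conformal coordinate: [z - z0] vanishes at the base point only and
    grows at least like the Euclidean distance. *)
Definition expanding (z1 z2 : R -> R -> R) : Prop := forall x y x' y',
  (x - x') * (x - x') + (y - y') * (y - y') <=
  (z1 x y - z1 x' y') * (z1 x y - z1 x' y') + (z2 x y - z2 x' y') * (z2 x y - z2 x' y').

(* With [T = |t - t0|^2], [S = |t + conj t0|^2 >= T] and [Z = |z - z0|^2], the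
   function [T^2 / (S^2 Z)] extends by [0] to the base point, decays at infinity,
   and its logarithm is harmonic wherever it is finite. *)
Lemma liouville (A11 A12 A22 z1 z2 t1 t2 : R -> R -> R) :
  unimodular A11 A12 A22 -> hol A11 A12 A22 z1 z2 -> expanding z1 z2 ->
  hol A11 A12 A22 t1 t2 -> (forall x y, 0 < t1 x y) ->
  forall x y, t1 x y = t1 0 0 /\ t2 x y = t2 0 0.
Proof.
  intros UA Hz Ez Ht Pt.
  set (T := sqn (fun x y => t1 x y + - t1 0 0) (fun x y => t2 x y + - t2 0 0)).
  set (S := sqn (fun x y => t1 x y + t1 0 0) (fun x y => t2 x y + - t2 0 0)).
  set (Z := sqn (fun x y => z1 x y + - z1 0 0) (fun x y => z2 x y + - z2 0 0)).
  assert (HT := hol_shift _ _ _ _ _ (- t1 0 0) (- t2 0 0) UA Ht).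
  assert (HS := hol_shift _ _ _ _ _ (t1 0 0) (- t2 0 0) UA Ht).
  assert (HZ := hol_shift _ _ _ _ _ (- z1 0 0) (- z2 0 0) UA Hz).
  assert (CT : forall x y, continuity_2d_pt T x y) by (intros; eapply hol_sqn_continuity, HT).
  assert (CS : forall x y, continuity_2d_pt S x y) by (intros; eapply hol_sqn_continuity, HS).
  assert (CZ : forall x y, continuity_2d_pt Z x y) by (intros; eapply hol_sqn_continuity, HZ).
  assert (T0 : forall x y, 0 <= T x y) by (intros; apply sqn_nonneg).
  assert (SP : forall x y, 0 < S x y).
  { intros x y; unfold S, sqn; pose proof (Pt x y); pose proof (Pt 0 0).
    apply Rplus_lt_le_0_compat; [nra | apply Rle_0_sqr]. }
  (* [S - T = 4 t1(x, y) t1(0, 0)], positive since the real part of [t] is. *)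
  assert (TS : forall x y, T x y <= S x y).
  { intros x y; assert (P := Rmult_lt_0_compat _ _ (Pt x y) (Pt 0 0)); unfold T, S, sqn; lra. }
  assert (ZE : forall x y, x * x + y * y <= Z x y).
  { intros x y; specialize (Ez x y 0 0); unfold Z, sqn; rewrite !Rminus_0_r in Ez; exact Ez. }
  assert (Z0 : forall x y, Z x y <> 0 -> 0 < Z x y).
  { intros x y N; assert (0 <= Z x y) by apply sqn_nonneg; lra. }
  assert (Zeq : forall x y, Z x y = 0 -> x = 0 /\ y = 0).
  { intros x y E; specialize (ZE x y); split; nra. }
  assert (SP2 : forall x y, 0 < S x y * S x y).
  { intros x y; specialize (SP x y); now apply Rmult_lt_0_compat. }
  (* At the base point [T = O(Z)], so [T / (S Z)] would only stay bounded; the second factor [T]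
     makes the quotient tend to [0]. Division by zero gives the same value [0] there. *)
  set (m := fun x y => T x y * T x y / (S x y * S x y * Z x y)).
  assert (m0 : forall x y, 0 <= m x y).
  { intros x y; unfold m, Rdiv; apply Rmult_le_pos; [nra | ].
    destruct (Req_dec (Z x y) 0) as [-> | N].
    - rewrite Rmult_0_r, Rinv_0; lra.
    - left; apply Rinv_0_lt_compat; apply Rmult_lt_0_compat; auto. }
  assert (Zm : forall x y, 0 < m x y -> 0 < Z x y /\ 0 < T x y).
  { intros x y P; split.
    - destruct (Req_dec (Z x y) 0) as [E | N]; [ | auto].
      unfold m in P; rewrite E, Rmult_0_r in P; unfold Rdiv in P; rewrite Rinv_0 in P; lra.
    - destruct (Req_dec (T x y) 0) as [E | N]; [ | specialize (T0 x y); lra].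
      unfold m in P; rewrite E in P; unfold Rdiv in P; rewrite !Rmult_0_l in P; lra. }
  assert (M : forall x y, m x y <= 0).
  { apply (decaying_nonpositive A22 (fun x y => - A12 x y) A11 m 0 0 1).
    - now apply unimodular_elliptic.
    - intros x y; destruct (Req_dec (Z x y) 0) as [E | N].
      + destruct (Zeq x y E) as [-> ->].
        destruct Ht as (u1 & u2 & v1 & v2 & H); destruct (H 0 0) as (U & V & _).
        destruct (dpl_sq_lipschitz _ _ _ _ _ U) as [C1 [C1p L1]].
        destruct (dpl_sq_lipschitz _ _ _ _ _ V) as [C2 [C2p L2]].
        apply (continuity_2d_pt_squeeze m (fun s t => (C1 + C2) * T s t * / (S s t * S s t))).
        * eapply locally_2d_impl; [ | exact (locally_2d_and _ _ _ _ L1 L2)].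
          apply locally_2d_forall; intros s t [I J]; split; [apply m0 | ].
          assert (TZ : T s t <= (C1 + C2) * Z s t).
          { specialize (ZE s t); rewrite !Rminus_0_r in I, J.
            apply Rle_trans with ((C1 + C2) * (s * s + t * t)); [unfold T, sqn; lra | nra]. }
          specialize (SP s t); specialize (T0 s t); specialize (ZE s t).
          assert (IS := Rinv_0_lt_compat _ (SP2 s t)).
          unfold m, Rdiv; destruct (Req_dec (Z s t) 0) as [E' | N'].
          -- rewrite E', Rmult_0_r, Rinv_0, Rmult_0_r; apply Rmult_le_pos; [ | lra].
             apply Rmult_le_pos; lra.
          -- rewrite Rinv_mult, <- Rmult_assoc, (Rmult_comm (_ * / _)).
             assert (ZP := Z0 s t N').
             rewrite <- Rmult_assoc; apply Rmult_le_compat_r; [lra | ].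
             apply (Rmult_le_reg_l (Z s t)); [exact ZP | ].
             replace (Z s t * (/ Z s t * (T s t * T s t))) with (T s t * T s t) by (field; lra).
             nra.
        * apply continuity_2d_pt_mult; [apply continuity_2d_pt_mult; [apply continuity_2d_pt_const | apply CT] | ].
          apply continuity_2d_pt_inv; [apply continuity_2d_pt_mult; apply CS | ].
          specialize (SP2 0 0); lra.
        * replace (T 0 0) with 0 by (unfold T, sqn; ring); ring.
      + apply continuity_2d_pt_mult; [apply continuity_2d_pt_mult; apply CT | ].
        apply continuity_2d_pt_inv; [repeat apply continuity_2d_pt_mult; auto | ].
        specialize (SP2 x y); apply Rmult_integral_contrapositive_currified; lra.
    - intros x y P; destruct (Zm x y P) as [ZP TP].
      exists (fun s t => 1 * (2 * ln (T s t) + -2 * ln (S s t)) + -1 * ln (Z s t)); split.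
      + replace 0 with (1 * (2 * 0 + -2 * 0) + -1 * 0) by ring.
        apply (second_order_op_lincomb _ _ _ 1 (-1) (fun s t => 2 * ln (T s t) + -2 * ln (S s t))).
        * apply second_order_op_lincomb; now apply hol_ln_sqn.
        * now apply hol_ln_sqn.
      + eapply locally_2d_impl; [ | exact (locally_2d_and _ _ _ _
          (continuity_2d_pt_pos _ _ _ (CT x y) TP) (continuity_2d_pt_pos _ _ _ (CZ x y) ZP))].
        apply locally_2d_forall; intros s t [TP' ZP']; specialize (SP s t).
        unfold m; rewrite <- (exp_ln (_ / _)) at 1.
        * f_equal; rewrite ln_div, !ln_mult; try nra; repeat apply Rmult_lt_0_compat; lra.
        * apply Rdiv_lt_0_compat; repeat apply Rmult_lt_0_compat; lra.
    - intros x y; rewrite !Rminus_0_r.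
      destruct (Rle_or_lt (m x y) 0) as [L | L].
      + specialize (m0 x y); replace (m x y) with 0 by lra; lra.
      + destruct (Zm x y L) as [ZP TP]; specialize (SP x y); specialize (TS x y).
        apply Rle_trans with (m x y * Z x y); [apply Rmult_le_compat_l; [lra | apply ZE] | ].
        unfold m; replace (_ * Z x y) with ((T x y * T x y) * / (S x y * S x y)) by (field; lra).
        apply (Rmult_le_reg_r (S x y * S x y)); [nra | ].
        rewrite Rmult_assoc, Rinv_l; nra. }
  intros x y; specialize (M x y).
  assert (TZ : T x y = 0).
  { destruct (Req_dec (Z x y) 0) as [E | N].
    - destruct (Zeq x y E) as [-> ->].
      unfold T, sqn; ring.
    - assert (ZP := Z0 x y N).
      specialize (T0 x y); destruct (Req_dec (T x y) 0) as [ | N']; [assumption | ].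
      exfalso.
      assert (0 < m x y); [ | lra].
      specialize (SP x y); apply Rdiv_lt_0_compat; repeat apply Rmult_lt_0_compat; lra. }
  apply sqn_eq0 in TZ; lra.
Qed.

(** * Joergens' theorem *)

Lemma dpl_unique (u : R -> R -> R) (x y a b a' b' : R) :
  dpl u x y a b -> dpl u x y a' b' -> a = a' /\ b = b'.
Proof.
  intros H H'; apply differentiable_pt_lim_unique in H; apply differentiable_pt_lim_unique in H'.
  destruct H, H'; split; congruence.
Qed.

(** These are the two partial derivatives of [det A = 1]. When the rows of [A] are the gradients of
    [P] and [Q], they become the harmonicity of [P] and [Q]. *)
Lemma unimodular_derivative (A11 A12 A22 : R -> R -> R) (x y a1 a2 b1 b2 c1 c2 : R) :
  unimodular A11 A12 A22 ->
  dpl A11 x y a1 a2 -> dpl A12 x y b1 b2 -> dpl A22 x y c1 c2 ->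
  A22 x y * a1 - 2 * A12 x y * b1 + A11 x y * c1 = 0 /\
  A22 x y * a2 - 2 * A12 x y * b2 + A11 x y * c2 = 0.
Proof.
  intros UA Ha Hb Hc.
  assert (D := dpl_lincomb 1 (-1) 0 _ _ _ _ _ _ _ _ (dpl_mult _ _ _ _ _ _ _ _ Ha Hc)
                 (dpl_mult _ _ _ _ _ _ _ _ Hb Hb)).
  assert (D' : dpl (fun s t => 1 * (A11 s t * A22 s t) + -1 * (A12 s t * A12 s t) + 0) x y 0 0).
  { apply (dpl_ext (fun s t => 0 * s + 0 * t + 1)); [ | apply dpl_affine].
    intros s t; destruct (UA s t) as [_ E]; lra. }
  destruct (dpl_unique _ _ _ _ _ _ _ D D'); split; lra.
Qed.

(* [P, Q] are the partial derivatives of a solution of [det D^2 E = 1]. *)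
Lemma hol_coordinates (A11 A12 A22 a b c d P Q : R -> R -> R) :
  unimodular A11 A12 A22 ->
  (forall x y, dpl A11 x y (a x y) (b x y)) ->
  (forall x y, dpl A12 x y (b x y) (c x y)) ->
  (forall x y, dpl A22 x y (c x y) (d x y)) ->
  (forall x y, dpl P x y (A11 x y) (A12 x y)) ->
  (forall x y, dpl Q x y (A12 x y) (A22 x y)) ->
  hol A11 A12 A22 (fun x _ => x) Q /\ hol A11 A12 A22 P (fun _ y => y).
Proof.
  intros UA Da Db Dc DP DQ.
  split.
  - exists (fun _ _ => 1), (fun _ _ => 0), A12, A22; intros x y.
    destruct (unimodular_derivative _ _ _ _ _ _ _ _ _ _ _ UA (Da x y) (Db x y) (Dc x y)).
    repeat split; auto using dpl_const; try ring.
    + apply dpl_fst.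
    + exists 0, 0, 0; repeat split; auto using dpl_const; ring.
    + exists (b x y), (c x y), (d x y); repeat split; auto.
  - exists A11, A12, (fun _ _ => 0), (fun _ _ => 1); intros x y.
    destruct (unimodular_derivative _ _ _ _ _ _ _ _ _ _ _ UA (Da x y) (Db x y) (Dc x y)).
    destruct (UA x y) as [_ E].
    repeat split; auto using dpl_const; try lra.
    + apply dpl_snd.
    + exists (a x y), (b x y), (c x y); repeat split; auto.
    + exists 0, 0, 0; repeat split; auto using dpl_const; ring.
Qed.

Lemma unimodular_pos (A11 A12 A22 : R -> R -> R) (x y a b : R) :
  unimodular A11 A12 A22 -> a <> 0 \/ b <> 0 ->
  0 < a * a * A11 x y + 2 * a * b * A12 x y + b * b * A22 x y.
Proof.
  intros UA N; destruct (UA x y) as [Pa E].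
  apply (Rmult_lt_reg_l (A11 x y)); [exact Pa | rewrite Rmult_0_r].
  replace (A11 x y * (a * a * A11 x y + 2 * a * b * A12 x y + b * b * A22 x y)) with
    ((a * A11 x y + b * A12 x y) * (a * A11 x y + b * A12 x y)
      + b * b * (A11 x y * A22 x y - A12 x y * A12 x y)) by ring.
  rewrite E; destruct (Req_dec b 0) as [-> | Nb].
  - destruct N as [N | N]; [ | lra].
    assert (a * A11 x y <> 0) by (apply Rmult_integral_contrapositive_currified; lra).
    replace (_ + _) with ((a * A11 x y) * (a * A11 x y)) by ring.
    now apply Rsqr_pos_lt.
  - apply Rplus_le_lt_0_compat; [apply Rle_0_sqr | rewrite Rmult_1_r; now apply Rsqr_pos_lt].
Qed.

(** [(P, Q)] is the gradient of a convex function with Hessian [A]; by the mean value theorem the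
    expression is a value of the quadratic form of [A] at a point of the segment. *)
Lemma gradient_monotone (A11 A12 A22 P Q : R -> R -> R) :
  unimodular A11 A12 A22 ->
  (forall x y, dpl P x y (A11 x y) (A12 x y)) ->
  (forall x y, dpl Q x y (A12 x y) (A22 x y)) ->
  forall x y x' y', x <> x' \/ y <> y' ->
    0 < (x - x') * (P x y - P x' y') + (y - y') * (Q x y - Q x' y').
Proof.
  intros UA DP DQ x y x' y' N; set (a := x - x'); set (b := y - y').
  set (k := fun s => a * P (x' + s * a) (y' + s * b) + b * Q (x' + s * a) (y' + s * b)).
  set (k' := fun s => let X := x' + s * a in let Y := y' + s * b in
          a * a * A11 X Y + 2 * a * b * A12 X Y + b * b * A22 X Y).
  destruct (MVT_cor2 k k' 0 1) as [c [E _]]; [lra | | ].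
  - intros s _; apply is_derive_Reals; unfold k, k'; cbv zeta.
    match goal with |- is_derive _ _ ?l => replace l with
      (plus (a * (a * A11 (x' + s * a) (y' + s * b) + b * A12 (x' + s * a) (y' + s * b)))
            (b * (a * A12 (x' + s * a) (y' + s * b) + b * A22 (x' + s * a) (y' + s * b))))
      by (unfold plus; simpl; ring) end.
    apply (is_derive_plus (fun s => a * P (x' + s * a) (y' + s * b))
             (fun s => b * Q (x' + s * a) (y' + s * b)));
      apply (is_derive_scal _ s); now apply dpl_line.
  - assert (Pk : 0 < k' c).
    { apply unimodular_pos; [exact UA | unfold a, b; destruct N; [left | right]; lra]. }
    unfold k in E; rewrite !Rmult_0_l, !Rplus_0_r, !Rmult_1_l in E.
    replace (x' + a) with x in E by (unfold a; ring).
    replace (y' + b) with y in E by (unfold b; ring).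
    lra.
Qed.

(** Lewy's transformation. In [|d + e|^2 = |d|^2 + 2 <d, e> + |e|^2], with [d] the increment of the
    point and [e] that of the gradient, the middle term is nonnegative by monotonicity. *)
Lemma expanding_sum (A11 A12 A22 P Q : R -> R -> R) :
  unimodular A11 A12 A22 ->
  (forall x y, dpl P x y (A11 x y) (A12 x y)) ->
  (forall x y, dpl Q x y (A12 x y) (A22 x y)) ->
  expanding (fun x y => x + P x y) (fun x y => y + Q x y).
Proof.
  intros UA DP DQ x y x' y'.
  assert (S1 := Rle_0_sqr (P x y - P x' y')); assert (S2 := Rle_0_sqr (Q x y - Q x' y')).
  unfold Rsqr in *.
  assert (M : 0 <= (x - x') * (P x y - P x' y') + (y - y') * (Q x y - Q x' y')).
  { destruct (Req_dec x x') as [-> | N]; [destruct (Req_dec y y') as [-> | N] | ].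
    - rewrite !Rminus_diag; lra.
    - left; apply (gradient_monotone A11 A12 A22); auto.
    - left; apply (gradient_monotone A11 A12 A22); auto. }
  lra.
Qed.

Lemma hol_sum (A11 A12 A22 P Q : R -> R -> R) : unimodular A11 A12 A22 ->
  hol A11 A12 A22 (fun x _ => x) Q -> hol A11 A12 A22 P (fun _ y => y) ->
  hol A11 A12 A22 (fun x y => x + P x y) (fun x y => y + Q x y).
Proof.
  intros UA H1 H2.
  eapply hol_ext; [ | | exact (hol_lincomb _ _ _ _ _ _ _ 1 0 1 0 0 0 UA H1 H2)];
    intros; simpl; ring.
Qed.

(** Origin of the exponents in [jorgens_gradient]: vanishing where [a] or [b] vanishes alone needs a
    power of [n] above [2], and decay when both are large needs one below [4]. If [a] or [b] is [0],
    then so is [n], and division by zero gives [0]. *)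
Lemma cube_quotient_bound (n a b K : R) :
  0 <= n -> 0 <= a -> 0 <= b -> 0 <= K -> n <= K * a -> n <= K * b ->
  0 <= n * n * n / (a * a * (b * b)) <= K * K * K * a * / (b * b).
Proof.
  intros Hn Ha Hb HK Ia Ib.
  destruct (Req_dec a 0) as [-> | Na]; [ | destruct (Req_dec b 0) as [-> | Nb]].
  1,2: replace n with 0 by lra; unfold Rdiv; rewrite ?Rmult_0_r, ?Rinv_0; lra.
  assert (Pa : 0 < a) by lra; assert (Pb : 0 < b) by lra.
  assert (P : 0 < a * a * (b * b)) by (repeat apply Rmult_lt_0_compat; lra).
  assert (N3 : n * n * n <= K * a * (K * a) * (K * a)).
  { repeat apply Rmult_le_compat; try lra; repeat apply Rmult_le_pos; lra. }
  split.
  - apply Rle_mult_inv_pos; [repeat apply Rmult_le_pos; lra | exact P].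
  - apply (Rmult_le_reg_r _ _ _ P).
    replace (n * n * n / (a * a * (b * b)) * (a * a * (b * b))) with (n * n * n) by (field; lra).
    replace (K * K * K * a * / (b * b) * (a * a * (b * b))) with
      (K * a * (K * a) * (K * a)) by (field; lra).
    exact N3.
Qed.

(* Write [r = P + iy], [s = x + iQ], [z = r + s] and let [c, e] be the values
   of [s, r] at [(1, 0)]. Then [N = c r - e s] vanishes at [(0, 0)] and [(1, 0)]
   and is at most linear in [z], so [|N|^6 / (|z|^4 |z - z(1,0)|^4)] vanishes at
   these two points and decays at infinity. *)
Lemma jorgens_gradient (A11 A12 A22 P Q : R -> R -> R) :
  unimodular A11 A12 A22 ->
  hol A11 A12 A22 (fun x _ => x) Q -> hol A11 A12 A22 P (fun _ y => y) ->
  (forall x y, dpl P x y (A11 x y) (A12 x y)) ->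
  (forall x y, dpl Q x y (A12 x y) (A22 x y)) ->
  P 0 0 = 0 -> Q 0 0 = 0 ->
  forall x y, P x y = P 1 0 * x + Q 1 0 * y.
Proof.
  intros UA Hs Hr DP DQ P0 Q0.
  set (rho := P 1 0); set (kap := Q 1 0).
  assert (Mono := gradient_monotone _ _ _ _ _ UA DP DQ).
  assert (Mono0 : forall x y, 0 <= x * P x y + y * Q x y).
  { intros x y; destruct (Req_dec x 0) as [-> | N]; [destruct (Req_dec y 0) as [-> | N] | ];
      [lra | specialize (Mono 0 y 0 0) | specialize (Mono x y 0 0)];
      rewrite P0, Q0, !Rminus_0_r in Mono; left; apply Mono; auto. }
  assert (Mono1 : forall x y, 0 <= (x - 1) * (P x y - rho) + y * (Q x y - kap)).
  { intros x y; destruct (Req_dec x 1) as [-> | N]; [destruct (Req_dec y 0) as [-> | N] | ];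
      [unfold rho; lra | specialize (Mono 1 y 1 0) | specialize (Mono x y 1 0)];
      rewrite (Rminus_0_r y) in Mono; left; apply Mono; auto. }
  (* [n = |N|^2] with [c = 1 + i kap] and [e = rho]; the real part of [N = 0] is the claim. *)
  set (n := sqn (fun x y => P x y - kap * y - rho * x) (fun x y => y + kap * P x y - rho * Q x y)).
  set (z0 := sqn (fun x y => x + P x y) (fun x y => y + Q x y)).
  set (z1 := sqn (fun x y => x + P x y + - (1 + rho)) (fun x y => y + Q x y + - kap)).
  assert (HZ := hol_sum _ _ _ _ _ UA Hs Hr).
  assert (HZ1 := hol_shift _ _ _ _ _ (- (1 + rho)) (- kap) UA HZ).
  assert (HN : hol A11 A12 A22 (fun x y => P x y - kap * y - rho * x)
                               (fun x y => y + kap * P x y - rho * Q x y)).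
  { eapply hol_ext; [ | | exact (hol_lincomb _ _ _ _ _ _ _ 1 kap (- rho) 0 0 0 UA Hr Hs)];
      intros; simpl; ring. }
  assert (Cn : forall x y, continuity_2d_pt n x y) by (intros; eapply hol_sqn_continuity, HN).
  assert (C0 : forall x y, continuity_2d_pt z0 x y) by (intros; eapply hol_sqn_continuity, HZ).
  assert (C1 : forall x y, continuity_2d_pt z1 x y) by (intros; eapply hol_sqn_continuity, HZ1).
  assert (n_pos : forall x y, 0 <= n x y) by (intros; apply sqn_nonneg).
  assert (z0_pos : forall x y, 0 <= z0 x y) by (intros; apply sqn_nonneg).
  assert (z1_pos : forall x y, 0 <= z1 x y) by (intros; apply sqn_nonneg).
  assert (E0 : forall x y, x * x + y * y <= z0 x y).
  { intros x y; specialize (Mono0 x y); unfold z0, sqn.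
    assert (S1 := Rle_0_sqr (P x y)); assert (S2 := Rle_0_sqr (Q x y)); unfold Rsqr in *; lra. }
  assert (E1 : forall x y, (x - 1) * (x - 1) + y * y <= z1 x y).
  { intros x y; specialize (Mono1 x y); unfold z1, sqn.
    assert (S1 := Rle_0_sqr (P x y - rho)); assert (S2 := Rle_0_sqr (Q x y - kap));
      unfold Rsqr in *; lra. }
  (* [K = 2 (|c|^2 + |e|^2)]: the parallelogram law bounds [|c r - e s|^2] by [K (|r|^2 + |s|^2)],
     and monotonicity, being [Re (r conj s) >= 0], bounds the bracket by [|r + s|^2]. *)
  set (K := 2 * (1 + kap * kap + rho * rho)).
  assert (K0 : 0 <= K) by (unfold K; nra).
  assert (CS : forall p y q x w : R, 0 <= x * p + y * q ->
     w = (p - kap * y - rho * x) * (p - kap * y - rho * x)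
       + (y + kap * p - rho * q) * (y + kap * p - rho * q) ->
     w <= K * ((x + p) * (x + p) + (y + q) * (y + q))).
  { intros p y q x w I ->.
    assert (B : K * (p * p + y * y + (x * x + q * q)) -
      ((p - kap * y - rho * x) * (p - kap * y - rho * x)
       + (y + kap * p - rho * q) * (y + kap * p - rho * q)) =
      (p - kap * y + rho * x) * (p - kap * y + rho * x)
       + (y + kap * p + rho * q) * (y + kap * p + rho * q)
       + 2 * (rho * rho) * (p * p + y * y) + 2 * (1 + kap * kap) * (x * x + q * q)).
    { unfold K; ring. }
    assert (0 <= (p - kap * y + rho * x) * (p - kap * y + rho * x)) by apply Rle_0_sqr.
    assert (0 <= (y + kap * p + rho * q) * (y + kap * p + rho * q)) by apply Rle_0_sqr.
    assert (0 <= 2 * (rho * rho) * (p * p + y * y)) by (apply Rmult_le_pos; nra).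
    assert (0 <= 2 * (1 + kap * kap) * (x * x + q * q)) by (apply Rmult_le_pos; nra).
    apply Rle_trans with (K * (p * p + y * y + (x * x + q * q))); [lra | ].
    apply Rmult_le_compat_l; [exact K0 | lra]. }
  clearbody K.
  assert (N0 : forall x y, n x y <= K * z0 x y).
  { intros x y; apply CS; [apply Mono0 | reflexivity]. }
  assert (N1 : forall x y, n x y <= K * z1 x y).
  (* Since [N] is linear in [(r, s)] and vanishes at [(1, 0)], subtracting from [r] and [s] their
     values there does not change it. *)
  { intros x y; replace (z1 x y) with
      ((x - 1 + (P x y - rho)) * (x - 1 + (P x y - rho)) + (y + (Q x y - kap)) * (y + (Q x y - kap)))
      by (unfold z1, sqn; ring).
    apply CS; [apply Mono1 | unfold n, sqn; ring]. }
  set (m := fun x y => n x y * n x y * n x y / (z0 x y * z0 x y * (z1 x y * z1 x y))).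
  assert (Bm : forall x y, 0 <= m x y <= K * K * K * z0 x y * / (z1 x y * z1 x y)).
  { intros x y; now apply cube_quotient_bound. }
  assert (Bm' : forall x y, 0 <= m x y <= K * K * K * z1 x y * / (z0 x y * z0 x y)).
  { intros x y; unfold m; rewrite (Rmult_comm (z0 x y * z0 x y)); now apply cube_quotient_bound. }
  assert (m_pos : forall x y, 0 < m x y -> 0 < n x y /\ 0 < z0 x y /\ 0 < z1 x y).
  { intros x y Pm; unfold m, Rdiv in Pm; split; [ | split].
    - destruct (Req_dec (n x y) 0) as [E | ]; [rewrite E, !Rmult_0_l in Pm; lra | ].
      specialize (n_pos x y); lra.
    - destruct (Req_dec (z0 x y) 0) as [E | ]; [ | specialize (z0_pos x y); lra].
      rewrite E, !Rmult_0_l, Rinv_0 in Pm; lra.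
    - destruct (Req_dec (z1 x y) 0) as [E | ]; [ | specialize (z1_pos x y); lra].
      rewrite E, !Rmult_0_r, Rinv_0 in Pm; lra. }
  assert (M : forall x y, m x y <= 0).
  { apply (decaying_nonpositive A22 (fun x y => - A12 x y) A11 m 0 0 (K * K * K)).
    - now apply unimodular_elliptic.
    - intros x y.
      destruct (Req_dec (z0 x y) 0) as [E | Nz0]; [ | destruct (Req_dec (z1 x y) 0) as [E | Nz1]].
      + assert (z1 x y <> 0).
        { intros E'; specialize (E0 x y); specialize (E1 x y); nra. }
        apply (continuity_2d_pt_squeeze _ (fun s t => K * K * K * z0 s t * / (z1 s t * z1 s t))).
        * apply locally_2d_forall, Bm.
        * apply continuity_2d_pt_mult;
            [apply continuity_2d_pt_mult; [apply continuity_2d_pt_const | apply C0] | ].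
          apply continuity_2d_pt_inv; [apply continuity_2d_pt_mult; apply C1 | ].
          now apply Rmult_integral_contrapositive_currified.
        * rewrite E; ring.
      + apply (continuity_2d_pt_squeeze _ (fun s t => K * K * K * z1 s t * / (z0 s t * z0 s t))).
        * apply locally_2d_forall, Bm'.
        * apply continuity_2d_pt_mult;
            [apply continuity_2d_pt_mult; [apply continuity_2d_pt_const | apply C1] | ].
          apply continuity_2d_pt_inv; [apply continuity_2d_pt_mult; apply C0 | ].
          now apply Rmult_integral_contrapositive_currified.
        * rewrite E; ring.
      + apply continuity_2d_pt_mult; [repeat apply continuity_2d_pt_mult; auto | ].
        apply continuity_2d_pt_inv; [repeat apply continuity_2d_pt_mult; auto | ].
        repeat apply Rmult_integral_contrapositive_currified; assumption.
    - intros x y Pm; destruct (m_pos x y Pm) as (Pn & Pz0 & Pz1).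
      exists (fun s t => 1 * (3 * ln (n s t) + -2 * ln (z0 s t)) + -2 * ln (z1 s t)); split.
      + replace 0 with (1 * (3 * 0 + -2 * 0) + -2 * 0) by ring.
        apply (second_order_op_lincomb _ _ _ 1 (-2) (fun s t => 3 * ln (n s t) + -2 * ln (z0 s t))).
        * apply second_order_op_lincomb; now apply hol_ln_sqn.
        * now apply hol_ln_sqn.
      + eapply locally_2d_impl; [ | exact (locally_2d_and _ _ _ _
          (continuity_2d_pt_pos _ _ _ (Cn x y) Pn) (locally_2d_and _ _ _ _
          (continuity_2d_pt_pos _ _ _ (C0 x y) Pz0) (continuity_2d_pt_pos _ _ _ (C1 x y) Pz1)))].
        apply locally_2d_forall; intros s t (I1 & I2 & I3).
        unfold m; rewrite <- (exp_ln (_ / _)) at 1.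
        * f_equal; rewrite ln_div, !ln_mult; try lra; repeat apply Rmult_lt_0_compat; lra.
        * apply Rdiv_lt_0_compat; repeat apply Rmult_lt_0_compat; lra.
    - intros x y; rewrite !Rminus_0_r.
      assert (K3 : 0 <= K * K * K) by (repeat apply Rmult_le_pos; assumption).
      destruct (Rle_or_lt (m x y) 0) as [L | L].
      + replace (m x y) with 0 by (specialize (Bm x y); lra); lra.
      + destruct (m_pos x y L) as (Pn & Pz0 & Pz1).
        apply Rle_trans with (m x y * z0 x y); [apply Rmult_le_compat_l; [lra | apply E0] | ].
        apply (Rmult_le_reg_r (z0 x y * (z1 x y * z1 x y)));
          [repeat apply Rmult_lt_0_compat; lra | ].
        unfold m; replace (n x y * n x y * n x y / _ * z0 x y * _) with
          (n x y * (n x y * n x y)) by (field; lra).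
        replace (K * K * K * _) with (K * z0 x y * (K * z1 x y * (K * z1 x y))) by ring.
        repeat apply Rmult_le_compat; auto; try lra; apply Rmult_le_pos; lra. }
  assert (n0 : forall x y, n x y = 0).
  { intros x y; specialize (M x y); specialize (n_pos x y).
    specialize (N0 x y); specialize (N1 x y); specialize (z0_pos x y); specialize (z1_pos x y).
    destruct (Req_dec (z0 x y) 0) as [E | Nz0]; [rewrite E in N0; lra | ].
    destruct (Req_dec (z1 x y) 0) as [E | Nz1]; [rewrite E in N1; lra | ].
    destruct (Req_dec (n x y) 0) as [ | Nn]; [assumption | exfalso].
    assert (0 < m x y); [ | lra].
    apply Rdiv_lt_0_compat; repeat apply Rmult_lt_0_compat; lra. }
  intros x y; specialize (n0 x y); apply sqn_eq0 in n0; lra.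
Qed.

(** The potential [P] of the first row is linear, so [A11] and [A12] are constant;
    [A22 = (1 + A12^2) / A11] then follows from the determinant. *)
Lemma jorgens (A11 A12 A22 a b c d : R -> R -> R) :
  unimodular A11 A12 A22 ->
  (forall x y, dpl A11 x y (a x y) (b x y)) ->
  (forall x y, dpl A12 x y (b x y) (c x y)) ->
  (forall x y, dpl A22 x y (c x y) (d x y)) ->
  (forall x y, continuity_2d_pt b x y) -> (forall x y, continuity_2d_pt c x y) ->
  exists p q r, forall x y, A11 x y = p /\ A12 x y = q /\ A22 x y = r.
Proof.
  intros UA Da Db Dc Cb Cc.
  assert (L1 : forall (u : R -> R -> R) x y l1 l2, dpl u x y l1 l2 ->
            is_derive (fun z => u z y) x l1).
  { intros u x y l1 l2 D.
    apply (is_derive_ext (fun t => u (0 + t * 1) (y + t * 0))).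
    - intros t; f_equal; ring.
    - replace l1 with (1 * l1 + 0 * l2) by ring; apply dpl_line.
      now replace (0 + x * 1) with x by ring; replace (y + x * 0) with y by ring. }
  assert (L2 : forall (u : R -> R -> R) x y l1 l2, dpl u x y l1 l2 ->
            is_derive (fun z => u x z) y l2).
  { intros u x y l1 l2 D.
    apply (is_derive_ext (fun t => u (x + t * 0) (0 + t * 1))).
    - intros t; f_equal; ring.
    - replace l2 with (0 * l1 + 1 * l2) by ring; apply dpl_line.
      now replace (x + y * 0) with x by ring; replace (0 + y * 1) with y by ring. }
  destruct (closed_form_potential A11 A12 b b) as (P & P0 & DP); eauto using dpl_continuity.
  destruct (closed_form_potential A12 A22 c c) as (Q & Q0 & DQ); eauto using dpl_continuity.
  destruct (hol_coordinates _ _ _ _ _ _ _ _ _ UA Da Db Dc DP DQ) as [Hs Hr].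
  assert (E := jorgens_gradient _ _ _ _ _ UA Hs Hr DP DQ P0 Q0).
  exists (P 1 0), (Q 1 0), ((1 + Q 1 0 * Q 1 0) / P 1 0); intros x y.
  assert (D : dpl P x y (P 1 0) (Q 1 0)).
  { apply (dpl_ext (fun s t => P 1 0 * s + Q 1 0 * t + 0)); [ | apply dpl_affine].
    intros s t; rewrite (E s t); ring. }
  destruct (dpl_unique _ _ _ _ _ _ _ (DP x y) D) as [<- <-].
  destruct (UA x y) as [Pa U]; repeat split.
  apply (Rmult_eq_reg_l (A11 x y)); [ | lra].
  replace (A11 x y * A22 x y) with (1 + A12 x y * A12 x y) by lra; field; lra.
Qed.

(** * Stationary graphs *)

Lemma pd4_immersion (f : R2 -> R2) (i : index) (x : R2) :
  pd4 i (immersion f) x = ((delta i i1, delta i i2), pd2 i f x).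
Proof.
  unfold pd4, immersion; f_equal; unfold pd2; destruct i; cbn; f_equal;
    first [apply Derive_id | apply Derive_const].
Qed.

Lemma pd4_pd4_immersion (f : R2 -> R2) (i j : index) (x : R2) :
  pd4 i (pd4 j (immersion f)) x =
  ((0, 0), (pd i (pd j (fun z => fst (f z))) x, pd i (pd j (fun z => snd (f z))) x)).
Proof.
  assert (E1 : pd i (fun z => fst (fst (pd4 j (immersion f) z))) x = 0).
  { destruct i; unfold pd;
      (rewrite (Derive_ext _ (fun _ => delta j i1)); [apply Derive_const | ]);
      intros t; now rewrite pd4_immersion. }
  assert (E2 : pd i (fun z => snd (fst (pd4 j (immersion f) z))) x = 0).
  { destruct i; unfold pd;
      (rewrite (Derive_ext _ (fun _ => delta j i2)); [apply Derive_const | ]);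
      intros t; now rewrite pd4_immersion. }
  unfold pd4 at 1; f_equal; unfold pd2 at 1; f_equal; assumption.
Qed.

Lemma normal_part_vertical (f : R2 -> R2) (x V : R2) : exists c1 c2,
  normal_part f x ((0, 0), V) =
  ((- c1, - c2),
   (fst V - (c1 * fst (pd2 i1 f x) + c2 * fst (pd2 i2 f x)),
    snd V - (c1 * snd (pd2 i1 f x) + c2 * snd (pd2 i2 f x)))).
Proof.
  exists (inv_metric f x i1 i1 * mink V (pd2 i1 f x) + inv_metric f x i2 i1 * mink V (pd2 i2 f x)),
         (inv_metric f x i1 i2 * mink V (pd2 i1 f x) + inv_metric f x i2 i2 * mink V (pd2 i2 f x)).
  unfold normal_part, sum2; rewrite !pd4_immersion.
  generalize (pd2 i1 f x) (pd2 i2 f x) (inv_metric f x); intros [p1 p2] [q1 q2] G.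
  destruct V as [V1 V2]; unfold delta, mink4, euclid, mink.
  apply injective_projections; apply injective_projections; simpl;
    repeat (unfold plus, opp, scal, mult; simpl);
    match goal with |- @eq _ ?a ?b => change (@eq R a b); ring end.
Qed.

(* The horizontal components of the mean curvature vector vanish, which forces
   the tangential part of [g^{ij} X_ij] to be zero. *)
Lemma stationary_laplacian (f : R2 -> R2) (x : R2) :
  det_metric f x <> 0 -> mean_curvature f x = zero ->
  forall u, u = (fun z => fst (f z)) \/ u = (fun z => snd (f z)) ->
  metric f x i2 i2 * pd i1 (pd i1 u) x
    - metric f x i1 i2 * (pd i1 (pd i2 u) x + pd i2 (pd i1 u) x)
    + metric f x i1 i1 * pd i2 (pd i2 u) x = 0.
Proof.
  intros D H u Hu.
  unfold mean_curvature, sum2 in H.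
  assert (C : forall i j, exists c1 c2, second_fundamental_form f x i j =
    ((- c1, - c2),
     (pd i (pd j (fun z => fst (f z))) x - (c1 * fst (pd2 i1 f x) + c2 * fst (pd2 i2 f x)),
      pd i (pd j (fun z => snd (f z))) x - (c1 * snd (pd2 i1 f x) + c2 * snd (pd2 i2 f x))))).
  { intros i j; unfold second_fundamental_form; rewrite pd4_pd4_immersion.
    exact (normal_part_vertical f x (_, _)). }
  destruct (C i1 i1) as (a1 & a2 & E1), (C i1 i2) as (b1 & b2 & E2),
    (C i2 i1) as (c1 & c2 & E3), (C i2 i2) as (d1 & d2 & E4).
  rewrite E1, E2, E3, E4 in H; clear C E1 E2 E3 E4.
  assert (S : inv_metric f x i2 i1 = inv_metric f x i1 i2).
  { unfold inv_metric, metric, mink; simpl; f_equal; ring. }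
  rewrite S in H.
  assert (G : inv_metric f x i1 i1 * pd i1 (pd i1 u) x
    + inv_metric f x i1 i2 * (pd i1 (pd i2 u) x + pd i2 (pd i1 u) x)
    + inv_metric f x i2 i2 * pd i2 (pd i2 u) x = 0).
  { generalize dependent (inv_metric f x); intros I H S.
    assert (Z1 := f_equal (fun Z : R4 => fst (fst Z)) H).
    assert (Z2 := f_equal (fun Z : R4 => snd (fst Z)) H).
    assert (Z3 := f_equal (fun Z : R4 => fst (snd Z)) H).
    assert (Z4 := f_equal (fun Z : R4 => snd (snd Z)) H).
    clear H; revert Z1 Z2 Z3 Z4.
    generalize (pd2 i1 f x) (pd2 i2 f x); intros [p1 p2] [q1 q2].
    destruct Hu as [-> | ->];
    generalize (pd i1 (pd i1 (fun z => fst (f z))) x) (pd i1 (pd i2 (fun z => fst (f z))) x)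
      (pd i2 (pd i1 (fun z => fst (f z))) x) (pd i2 (pd i2 (fun z => fst (f z))) x)
      (pd i1 (pd i1 (fun z => snd (f z))) x) (pd i1 (pd i2 (fun z => snd (f z))) x)
      (pd i2 (pd i1 (fun z => snd (f z))) x) (pd i2 (pd i2 (fun z => snd (f z))) x);
      intros u11 u12 u21 u22 v11 v12 v21 v22;
      repeat (unfold plus, scal, mult, zero; simpl); intros Z1 Z2 Z3 Z4.
    - assert (Y1 := f_equal (Rmult p1) Z1); assert (Y2 := f_equal (Rmult q1) Z2); lra.
    - assert (Y1 := f_equal (Rmult p2) Z1); assert (Y2 := f_equal (Rmult q2) Z2); lra. }
  unfold inv_metric in G; apply (Rmult_eq_reg_l (/ det_metric f x));
    [ | now apply Rinv_neq_0_compat].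
  rewrite Rmult_0_r, <- G; field; exact D.
Qed.

Lemma dpl_over_sqrt (g D : R -> R -> R) (x y g1 g2 d1 d2 : R) :
  0 < D x y -> dpl g x y g1 g2 -> dpl D x y d1 d2 ->
  dpl (fun s t => g s t / sqrt (D s t)) x y
    ((2 * D x y * g1 - g x y * d1) / (2 * D x y * sqrt (D x y)))
    ((2 * D x y * g2 - g x y * d2) / (2 * D x y * sqrt (D x y))).
Proof.
  intros P Hg HD.
  assert (PS := sqrt_lt_R0 _ P); assert (SS := sqrt_sqrt _ (Rlt_le _ _ P)).
  assert (HI : is_derive (fun z => / sqrt z) (D x y)
                 (- / (2 * (sqrt (D x y) * sqrt (D x y)) * sqrt (D x y)))).
  { auto_derive; [split; [exact P | split; [lra | exact I]] | field; lra]. }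
  rewrite SS in HI.
  eapply dpl_eq; [apply (dpl_mult _ _ _ _ _ _ _ _ Hg (dpl_comp1 _ _ _ _ _ _ _ HI HD)) | | ];
    field; lra.
Qed.

Definition mink_prod (U1 U2 V1 V2 : R -> R -> R) (x y : R) : R := U1 x y * U2 x y - V1 x y * V2 x y.

Lemma dpl_mink_prod (U1 U2 V1 V2 : R -> R -> R) (x y u11 u12 u21 u22 v11 v12 v21 v22 k : R) :
  dpl U1 x y u11 u12 -> dpl U2 x y u21 u22 ->
  dpl V1 x y v11 v12 -> dpl V2 x y v21 v22 ->
  dpl (fun s t => k + mink_prod U1 U2 V1 V2 s t) x y
    (u11 * U2 x y + U1 x y * u21 - (v11 * V2 x y + V1 x y * v21))
    (u12 * U2 x y + U1 x y * u22 - (v12 * V2 x y + V1 x y * v22)).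
Proof.
  intros H1 H2 H3 H4.
  apply (dpl_ext (fun s t => 1 * (U1 s t * U2 s t) + -1 * (V1 s t * V2 s t) + k));
    [intros; unfold mink_prod; ring | ].
  eapply dpl_eq; [apply dpl_lincomb; apply dpl_mult; eassumption | ring | ring].
Qed.

(** [U] and [V] stand for the two components of [f]. The two equations at the end of the hypotheses
    make the rows of [g / W] closed, so that [jorgens] applies to it. *)
Lemma metric_constant (U1 U2 U11 U12 U22 V1 V2 V11 V12 V22 : R -> R -> R) :
  let G11 := fun x y => 1 + mink_prod U1 U1 V1 V1 x y in
  let G12 := fun x y => 0 + mink_prod U1 U2 V1 V2 x y in
  let G22 := fun x y => 1 + mink_prod U2 U2 V2 V2 x y in
  let D := fun x y => G11 x y * G22 x y - G12 x y * G12 x y in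
  (forall x y, dpl U1 x y (U11 x y) (U12 x y)) ->
  (forall x y, dpl U2 x y (U12 x y) (U22 x y)) ->
  (forall x y, dpl V1 x y (V11 x y) (V12 x y)) ->
  (forall x y, dpl V2 x y (V12 x y) (V22 x y)) ->
  (forall x y, continuity_2d_pt U11 x y) -> (forall x y, continuity_2d_pt U12 x y) ->
  (forall x y, continuity_2d_pt U22 x y) -> (forall x y, continuity_2d_pt V11 x y) ->
  (forall x y, continuity_2d_pt V12 x y) -> (forall x y, continuity_2d_pt V22 x y) ->
  (forall x y, 0 < G11 x y) -> (forall x y, 0 < D x y) ->
  (forall x y, G22 x y * U11 x y - 2 * G12 x y * U12 x y + G11 x y * U22 x y = 0) ->
  (forall x y, G22 x y * V11 x y - 2 * G12 x y * V12 x y + G11 x y * V22 x y = 0) ->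
  exists p q r, forall x y,
    0 < p /\ p * r - q * q = 1 /\
    G11 x y = p * sqrt (D x y) /\ G12 x y = q * sqrt (D x y) /\ G22 x y = r * sqrt (D x y).
Proof.
  intros G11 G12 G22 D DU1 DU2 DV1 DV2 CU11 CU12 CU22 CV11 CV12 CV22 PG PD EU EV.
  set (P11 := fun x y => U11 x y * U1 x y + U1 x y * U11 x y - (V11 x y * V1 x y + V1 x y * V11 x y)).
  set (Q11 := fun x y => U12 x y * U1 x y + U1 x y * U12 x y - (V12 x y * V1 x y + V1 x y * V12 x y)).
  set (P12 := fun x y => U11 x y * U2 x y + U1 x y * U12 x y - (V11 x y * V2 x y + V1 x y * V12 x y)).
  set (Q12 := fun x y => U12 x y * U2 x y + U1 x y * U22 x y - (V12 x y * V2 x y + V1 x y * V22 x y)).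
  set (P22 := fun x y => U12 x y * U2 x y + U2 x y * U12 x y - (V12 x y * V2 x y + V2 x y * V12 x y)).
  set (Q22 := fun x y => U22 x y * U2 x y + U2 x y * U22 x y - (V22 x y * V2 x y + V2 x y * V22 x y)).
  set (PDt := fun x y => G22 x y * P11 x y + G11 x y * P22 x y - 2 * G12 x y * P12 x y).
  set (QDt := fun x y => G22 x y * Q11 x y + G11 x y * Q22 x y - 2 * G12 x y * Q12 x y).
  assert (D11 : forall x y, dpl G11 x y (P11 x y) (Q11 x y)) by (intros; now apply dpl_mink_prod).
  assert (D12 : forall x y, dpl G12 x y (P12 x y) (Q12 x y)) by (intros; now apply dpl_mink_prod).
  assert (D22 : forall x y, dpl G22 x y (P22 x y) (Q22 x y)) by (intros; now apply dpl_mink_prod).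
  assert (DD : forall x y, dpl D x y (PDt x y) (QDt x y)).
  { intros x y.
    apply (dpl_ext (fun s t => 1 * (G11 s t * G22 s t) + -1 * (G12 s t * G12 s t) + 0));
      [intros; unfold D; ring | ].
    eapply dpl_eq; [apply dpl_lincomb; apply dpl_mult; auto | unfold PDt; ring | unfold QDt; ring]. }
  (* A partial derivative of [g / W], when [h] and [k] are the same partial derivative of [g] and
     [D]. *)
  set (q := fun (g h k : R -> R -> R) x y =>
    (2 * D x y * h x y - g x y * k x y) / (2 * D x y * sqrt (D x y))).
  (* Closedness of the first row of [g / W], cleared of its denominator. With [L f] the left side of
     the two equations, the difference is [2 g12]- and [2 g11]-multiples of tangential products:
     [2 g11 <L f, f_y> - 2 g12 <L f, f_x>]. [E2] is the second row. *)
  assert (E1 : forall x y, 2 * D x y * P12 x y - G12 x y * PDt x y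
                = 2 * D x y * Q11 x y - G11 x y * QDt x y).
  { intros x y; specialize (EU x y); specialize (EV x y).
    apply Rminus_diag_uniq.
    transitivity (2 * G11 x y * (U2 x y * (G22 x y * U11 x y - 2 * G12 x y * U12 x y + G11 x y * U22 x y)
                      - V2 x y * (G22 x y * V11 x y - 2 * G12 x y * V12 x y + G11 x y * V22 x y))
      - 2 * G12 x y * (U1 x y * (G22 x y * U11 x y - 2 * G12 x y * U12 x y + G11 x y * U22 x y)
                      - V1 x y * (G22 x y * V11 x y - 2 * G12 x y * V12 x y + G11 x y * V22 x y))).
    - unfold D, PDt, QDt, P11, P12, P22, Q11, Q12, Q22; ring.
    - rewrite EU, EV; ring. }
  assert (E2 : forall x y, 2 * D x y * P22 x y - G22 x y * PDt x y
                = 2 * D x y * Q12 x y - G12 x y * QDt x y).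
  { intros x y; specialize (EU x y); specialize (EV x y).
    apply Rminus_diag_uniq.
    transitivity (2 * G12 x y * (U2 x y * (G22 x y * U11 x y - 2 * G12 x y * U12 x y + G11 x y * U22 x y)
                      - V2 x y * (G22 x y * V11 x y - 2 * G12 x y * V12 x y + G11 x y * V22 x y))
      - 2 * G22 x y * (U1 x y * (G22 x y * U11 x y - 2 * G12 x y * U12 x y + G11 x y * U22 x y)
                      - V1 x y * (G22 x y * V11 x y - 2 * G12 x y * V12 x y + G11 x y * V22 x y))).
    - unfold D, PDt, QDt, P11, P12, P22, Q11, Q12, Q22; ring.
    - rewrite EU, EV; ring. }
  assert (PS : forall x y, 0 < sqrt (D x y)) by (intros; apply sqrt_lt_R0, PD).
  assert (UA : unimodular (fun x y => G11 x y / sqrt (D x y)) (fun x y => G12 x y / sqrt (D x y))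
                 (fun x y => G22 x y / sqrt (D x y))).
  { intros x y; split; [now apply Rdiv_lt_0_compat | ].
    specialize (PS x y); apply (Rmult_eq_reg_r (sqrt (D x y) * sqrt (D x y))).
    - rewrite sqrt_sqrt at 2; [ | left; apply PD]; unfold D; field; exact (Rgt_not_eq _ _ PS).
    - apply Rmult_integral_contrapositive_currified; lra. }
  assert (CG : forall x y, continuity_2d_pt G11 x y /\ continuity_2d_pt G12 x y /\
     continuity_2d_pt G22 x y /\ continuity_2d_pt D x y /\ continuity_2d_pt U1 x y /\
     continuity_2d_pt U2 x y /\ continuity_2d_pt V1 x y /\ continuity_2d_pt V2 x y).
  { intros x y; repeat split; eapply dpl_continuity; auto. }
  assert (CPQ : forall x y, continuity_2d_pt (fun s t => 2 * D s t * Q11 s t - G11 s t * QDt s t) x y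
     /\ continuity_2d_pt (fun s t => 2 * D s t * Q12 s t - G12 s t * QDt s t) x y).
  { intros x y; destruct (CG x y) as (? & ? & ? & ? & ? & ? & ? & ?).
    unfold QDt, Q11, Q12, Q22; split;
    repeat first [apply continuity_2d_pt_minus | apply continuity_2d_pt_plus
       | apply continuity_2d_pt_mult | apply continuity_2d_pt_const]; auto. }
  assert (CDS : forall x y, continuity_2d_pt (fun s t => / (2 * D s t * sqrt (D s t))) x y).
  { intros x y; destruct (CG x y) as (_ & _ & _ & C & _); specialize (PD x y); specialize (PS x y).
    apply continuity_2d_pt_inv.
    - repeat apply continuity_2d_pt_mult; [apply continuity_2d_pt_const | exact C | ].
      apply continuity_1d_2d_pt_comp; [apply continuity_pt_sqrt; lra | exact C].
    - repeat apply Rmult_integral_contrapositive_currified; lra. }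
  destruct (jorgens _ _ _ (q G11 P11 PDt) (q G11 Q11 QDt) (q G12 Q12 QDt) (q G22 Q22 QDt) UA)
    as (p & w & r & H).
  - intros x y; now apply dpl_over_sqrt.
  - intros x y; eapply dpl_eq; [now apply dpl_over_sqrt | | reflexivity].
    unfold q; now rewrite E1.
  - intros x y; eapply dpl_eq; [now apply dpl_over_sqrt | | reflexivity].
    unfold q; now rewrite E2.
  - intros x y; apply continuity_2d_pt_mult; [apply CPQ | apply CDS].
  - intros x y; apply continuity_2d_pt_mult; [apply CPQ | apply CDS].
  - exists p, w, r; intros x y; destruct (H x y) as (H1 & H2 & H3), (UA x y) as (L1 & L2).
    rewrite H1, H2, H3 in L2; rewrite H1 in L1; specialize (PS x y).
    repeat split; auto; [rewrite <- H1 | rewrite <- H2 | rewrite <- H3]; field; lra.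
Qed.

(** * Constant conformal structure *)

Definition D1 (u : R -> R -> R) (x y : R) : R := Derive (fun t => u t y) x.
Definition D2 (u : R -> R -> R) (x y : R) : R := Derive (fun t => u x t) y.
Definition Cinf (u : R -> R -> R) : Prop := forall n x y, ex_diff_n u n x y.

Lemma Cinf_D1 (u : R -> R -> R) : Cinf u -> Cinf (D1 u).
Proof. intros H n x y; apply (ex_diff_n_deriv_aux1 u n), H. Qed.

Lemma Cinf_D2 (u : R -> R -> R) : Cinf u -> Cinf (D2 u).
Proof. intros H n x y; apply (ex_diff_n_deriv_aux2 u n), H. Qed.

Lemma Cinf_continuity (u : R -> R -> R) (x y : R) : Cinf u -> continuity_2d_pt u x y.
Proof. intros H; exact (proj1 (H 0%nat x y)). Qed.

Lemma Cinf_ex_derive (u : R -> R -> R) (x y : R) : Cinf u ->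
  ex_derive (fun z => u z y) x /\ ex_derive (fun z => u x z) y.
Proof. intros H; destruct (H 1%nat x y) as (_ & Hx & Hy & _); now split. Qed.

Lemma Cinf_dpl (u : R -> R -> R) (x y : R) : Cinf u -> dpl u x y (D1 u x y) (D2 u x y).
Proof.
  intros H; apply dpl_of_C1.
  - intros s t; exact (Derive_correct _ _ (proj1 (Cinf_ex_derive u s t H))).
  - intros s t; exact (Derive_correct _ _ (proj2 (Cinf_ex_derive u s t H))).
  - now apply Cinf_continuity, Cinf_D1.
Qed.

Lemma Cinf_Schwarz (u : R -> R -> R) (x y : R) : Cinf u -> D1 (D2 u) x y = D2 (D1 u) x y.
Proof.
  intros H; apply Schwarz.
  - apply locally_2d_forall; intros s t; repeat split.
    + exact (proj1 (Cinf_ex_derive u s t H)).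
    + exact (proj2 (Cinf_ex_derive u s t H)).
    + exact (proj1 (Cinf_ex_derive (D2 u) s t (Cinf_D2 _ H))).
    + exact (proj2 (Cinf_ex_derive (D1 u) s t (Cinf_D1 _ H))).
  - exact (Cinf_continuity (D1 (D2 u)) x y (Cinf_D1 _ (Cinf_D2 _ H))).
  - exact (Cinf_continuity (D2 (D1 u)) x y (Cinf_D2 _ (Cinf_D1 _ H))).
Qed.

(** Third order is what [hol] needs for a first derivative of [u]. Mixed partials are identified
    once and for all, and the notion passes to linear combinations. *)
Definition jet3 (u u1 u2 u11 u12 u22 : R -> R -> R) : Prop :=
  exists u111 u112 u122 u222 : R -> R -> R, forall x y,
    dpl u x y (u1 x y) (u2 x y) /\
    dpl u1 x y (u11 x y) (u12 x y) /\ dpl u2 x y (u12 x y) (u22 x y) /\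
    dpl u11 x y (u111 x y) (u112 x y) /\ dpl u12 x y (u112 x y) (u122 x y) /\
    dpl u22 x y (u122 x y) (u222 x y).

Lemma Cinf_jet3 (u : R -> R -> R) : Cinf u ->
  jet3 u (D1 u) (D2 u) (D1 (D1 u)) (D2 (D1 u)) (D2 (D2 u)).
Proof.
  intros H; assert (H1 := Cinf_D1 _ H); assert (H2 := Cinf_D2 _ H).
  exists (D1 (D1 (D1 u))), (D2 (D1 (D1 u))), (D2 (D2 (D1 u))), (D2 (D2 (D2 u))).
  intros x y; repeat split.
  - now apply Cinf_dpl.
  - now apply Cinf_dpl.
  - eapply dpl_eq; [now apply Cinf_dpl | now apply Cinf_Schwarz | reflexivity].
  - now apply Cinf_dpl, Cinf_D1.
  - eapply dpl_eq; [now apply Cinf_dpl, Cinf_D2 | now apply Cinf_Schwarz | reflexivity].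
  - eapply dpl_eq; [now apply Cinf_dpl, Cinf_D2 | | reflexivity].
    rewrite Cinf_Schwarz; [ | exact H2].
    apply Derive_ext; intros t; now apply Cinf_Schwarz.
Qed.

Lemma jet3_lincomb (p q : R) (u u1 u2 u11 u12 u22 v v1 v2 v11 v12 v22 : R -> R -> R) :
  jet3 u u1 u2 u11 u12 u22 -> jet3 v v1 v2 v11 v12 v22 ->
  jet3 (fun x y => p * u x y + q * v x y + 0)
    (fun x y => p * u1 x y + q * v1 x y + 0) (fun x y => p * u2 x y + q * v2 x y + 0)
    (fun x y => p * u11 x y + q * v11 x y + 0) (fun x y => p * u12 x y + q * v12 x y + 0)
    (fun x y => p * u22 x y + q * v22 x y + 0).
Proof.
  intros (u111 & u112 & u122 & u222 & H) (v111 & v112 & v122 & v222 & G).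
  exists (fun x y => p * u111 x y + q * v111 x y + 0), (fun x y => p * u112 x y + q * v112 x y + 0),
         (fun x y => p * u122 x y + q * v122 x y + 0), (fun x y => p * u222 x y + q * v222 x y + 0).
  intros x y; destruct (H x y) as (? & ? & ? & ? & ? & ?), (G x y) as (? & ? & ? & ? & ? & ?).
  repeat split; (eapply dpl_eq; [apply dpl_lincomb; eassumption | ring | ring]).
Qed.

(** The conjugate of the derivative of [u] along [d] is the derivative along [A d] turned by a right
    angle, a direction orthogonal to [d] for [A]. Differentiating the constant-coefficient equation
    shows that both are harmonic. *)
Lemma hol_directional (p q r d1 d2 : R) (u u1 u2 u11 u12 u22 : R -> R -> R) :
  jet3 u u1 u2 u11 u12 u22 ->
  (forall x y, r * u11 x y - 2 * q * u12 x y + p * u22 x y = 0) ->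
  hol (fun _ _ => p) (fun _ _ => q) (fun _ _ => r)
    (fun x y => d1 * u1 x y + d2 * u2 x y + 0)
    (fun x y => (r * d2 + q * d1) * u1 x y + (- q * d2 - p * d1) * u2 x y + 0).
Proof.
  intros (u111 & u112 & u122 & u222 & H) E.
  assert (E3 : forall x y, r * u111 x y - 2 * q * u112 x y + p * u122 x y = 0 /\
                           r * u112 x y - 2 * q * u122 x y + p * u222 x y = 0).
  { intros x y; destruct (H x y) as (_ & _ & _ & H1 & H2 & H3).
    assert (D := dpl_lincomb 1 p 0 _ _ _ _ _ _ _ _ (dpl_lincomb r (- 2 * q) 0 _ _ _ _ _ _ _ _ H1 H2) H3).
    assert (D' : dpl (fun s t => 1 * (r * u11 s t + -2 * q * u12 s t + 0) + p * u22 s t + 0) x y 0 0).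
    { apply (dpl_ext (fun s t => 0 * s + 0 * t + 0)); [ | apply dpl_affine].
      intros s t; specialize (E s t); lra. }
    destruct (dpl_unique _ _ _ _ _ _ _ D D'); split; lra. }
  exists (fun x y => d1 * u11 x y + d2 * u12 x y + 0), (fun x y => d1 * u12 x y + d2 * u22 x y + 0),
    (fun x y => (r * d2 + q * d1) * u11 x y + (- q * d2 - p * d1) * u12 x y + 0),
    (fun x y => (r * d2 + q * d1) * u12 x y + (- q * d2 - p * d1) * u22 x y + 0).
  intros x y; destruct (H x y) as (_ & H1 & H2 & H3 & H4 & H5), (E3 x y) as [Ex Ey].
  specialize (E x y).
  repeat split.
  - eapply dpl_eq; [apply dpl_lincomb; eassumption | ring | ring].
  - eapply dpl_eq; [apply dpl_lincomb; eassumption | ring | ring].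
  - assert (Z := f_equal (Rmult d2) E); lra.
  - assert (Z := f_equal (Rmult d1) E); lra.
  - do 3 eexists; split; [apply dpl_lincomb; eassumption | split; [apply dpl_lincomb; eassumption | ]].
    assert (Z1 := f_equal (Rmult d1) Ex); assert (Z2 := f_equal (Rmult d2) Ey); lra.
  - do 3 eexists; split; [apply dpl_lincomb; eassumption | split; [apply dpl_lincomb; eassumption | ]].
    assert (Z1 := f_equal (Rmult (r * d2 + q * d1)) Ex).
    assert (Z2 := f_equal (Rmult (- q * d2 - p * d1)) Ey); lra.
Qed.

Lemma affine_of_constant_gradient (u : R -> R -> R) (a b : R) :
  (forall x y, dpl u x y a b) -> forall x y, u x y = u 0 0 + a * x + b * y.
Proof.
  intros H x y.
  destruct (MVT_cor2 (fun s => u (0 + s * x) (0 + s * y)) (fun _ => x * a + y * b) 0 1)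
    as [c [E _]]; [lra | | ].
  - intros s _; now apply is_derive_Reals, dpl_line.
  - rewrite !Rmult_0_l, !Rmult_1_l, !Rplus_0_l in E; lra.
Qed.

Lemma continuous_nonvanishing_sign (u : R -> R -> R) :
  (forall x y, continuity_2d_pt u x y) -> (forall x y, u x y <> 0) ->
  (forall x y, 0 < u x y) \/ (forall x y, 0 < - u x y).
Proof.
  intros C N.
  assert (S : forall x y, 0 < u 0 0 * u x y).
  { intros x y; destruct (Rlt_or_le 0 (u 0 0 * u x y)) as [ | L]; [assumption | exfalso].
    assert (Ck : continuity (fun s => u (s * x) (s * y))).
    { intros s; apply continuity_pt_filterlim.
      apply (continuous_comp_2 (fun s => s * x) (fun s => s * y) u).
      - apply (ex_derive_continuous (fun s => s * x)); auto_derive; auto.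
      - apply (ex_derive_continuous (fun s => s * y)); auto_derive; auto.
      - apply continuity_2d_pt_filterlim, C. }
    destruct (IVT_cor (fun s => u (s * x) (s * y)) 0 1 Ck) as [z [_ E]]; [lra | | ].
    - rewrite !Rmult_0_l, !Rmult_1_l; exact L.
    - exact (N _ _ E). }
  destruct (Rtotal_order (u 0 0) 0) as [L | [E | L]].
  - right; intros x y; specialize (S x y); nra.
  - now apply N in E.
  - left; intros x y; specialize (S x y); nra.
Qed.

(** After replacing [d] by [- d] if necessary, the derivative along [d] is positive and [liouville]
    applies to it and its conjugate, with the linear expanding map [I + A]. *)
Lemma constant_gradient_of_nonvanishing (p q r d1 d2 : R) (u u1 u2 u11 u12 u22 : R -> R -> R) :
  0 < p -> p * r - q * q = 1 -> d1 <> 0 \/ d2 <> 0 ->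
  jet3 u u1 u2 u11 u12 u22 ->
  (forall x y, r * u11 x y - 2 * q * u12 x y + p * u22 x y = 0) ->
  (forall x y, d1 * u1 x y + d2 * u2 x y <> 0) ->
  exists a b, forall x y, dpl u x y a b.
Proof.
  intros Pp Det Nd J E N.
  assert (UA : unimodular (fun _ _ => p) (fun _ _ => q) (fun _ _ => r)) by (intros x y; split; lra).
  assert (HH : forall e1 e2, e1 <> 0 \/ e2 <> 0 ->
            (forall x y, 0 < e1 * u1 x y + e2 * u2 x y + 0) ->
            exists a b, forall x y, dpl u x y a b).
  { intros e1 e2 Ne Pe; exists (u1 0 0), (u2 0 0); intros x y.
    set (P := fun x y => p * x + q * y + 0); set (Q := fun x y => q * x + r * y + 0).
    assert (DP : forall x y, dpl P x y p q) by (intros; apply dpl_affine).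
    assert (DQ : forall x y, dpl Q x y q r) by (intros; apply dpl_affine).
    destruct (hol_coordinates _ _ _ (fun _ _ => 0) (fun _ _ => 0) (fun _ _ => 0) (fun _ _ => 0)
                _ _ UA (dpl_const p) (dpl_const q) (dpl_const r) DP DQ) as [Hs Hr].
    destruct (liouville _ _ _ _ _ _ _ UA (hol_sum _ _ _ _ _ UA Hs Hr)
      (expanding_sum _ _ _ _ _ UA DP DQ) (hol_directional p q r e1 e2 _ _ _ _ _ _ J E) Pe x y)
      as [T1 T2].
    assert (Pdet := unimodular_pos _ _ _ x y e1 e2 UA Ne); cbn beta in Pdet.
    destruct J as (? & ? & ? & ? & J); destruct (J x y) as (Du & _).
    (* Cramer's rule for the two constant directional derivatives; up to sign the determinant is
       [A(e, e) > 0]. *)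
    assert (X1 : (e1 * e1 * p + 2 * e1 * e2 * q + e2 * e2 * r) * (u1 x y - u1 0 0) = 0).
    { assert (Z1 := f_equal (Rmult (q * e2 + p * e1)) T1); assert (Z2 := f_equal (Rmult e2) T2); lra. }
    assert (X2 : (e1 * e1 * p + 2 * e1 * e2 * q + e2 * e2 * r) * (u2 x y - u2 0 0) = 0).
    { assert (Z1 := f_equal (Rmult (r * e2 + q * e1)) T1); assert (Z2 := f_equal (Rmult e1) T2); lra. }
    apply Rmult_integral in X1; apply Rmult_integral in X2.
    eapply dpl_eq; [exact Du | destruct X1; lra | destruct X2; lra]. }
  destruct (continuous_nonvanishing_sign (fun x y => d1 * u1 x y + d2 * u2 x y + 0)) as [S | S].
  - intros x y; destruct J as (? & ? & ? & ? & J); destruct (J x y) as (_ & H1 & H2 & _).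
    eapply dpl_continuity, dpl_lincomb; eassumption.
  - intros x y; rewrite Rplus_0_r; apply N.
  - now apply (HH d1 d2).
  - apply (HH (- d1) (- d2)); [destruct Nd; [left | right]; lra | ].
    intros x y; specialize (S x y); lra.
Qed.

(* The maximum principle for [|t|^2 / |z - z0|^(2k)], which is continuous because
   [t] vanishes near [z0], gives [|t(a,b)|^2 <= M 2^(-k)] for all [k]. *)
Lemma unique_continuation (t1 t2 : R -> R -> R) (x0 y0 : R) :
  hol (fun _ _ => 1) (fun _ _ => 0) (fun _ _ => 1) t1 t2 ->
  locally_2d (fun x y => sqn t1 t2 x y = 0) x0 y0 ->
  forall a b, sqn t1 t2 a b = 0.
Proof.
  intros Ht L a b.
  assert (UA : unimodular (fun _ _ => 1) (fun _ _ => 0) (fun _ _ => 1)) by (intros x y; lra).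
  set (S := sqn t1 t2) in *.
  set (Z := sqn (fun x y => x + - x0) (fun x y => y + - y0)).
  assert (HZ : hol (fun _ _ => 1) (fun _ _ => 0) (fun _ _ => 1)
                 (fun x y => x + - x0) (fun x y => y + - y0)).
  { apply (hol_shift _ _ _ (fun x _ => x) (fun _ y => y)); [exact UA | ].
    apply (hol_coordinates _ _ _ (fun _ _ => 0) (fun _ _ => 0) (fun _ _ => 0) (fun _ _ => 0)
             (fun x _ => x) (fun _ y => y)); auto using dpl_const; intros x y.
    - apply dpl_fst.
    - apply dpl_snd. }
  assert (CS : forall x y, continuity_2d_pt S x y) by (intros; eapply hol_sqn_continuity, Ht).
  assert (CZ : forall x y, continuity_2d_pt Z x y) by (intros; eapply hol_sqn_continuity, HZ).
  assert (S0 : forall x y, 0 <= S x y) by (intros; apply sqn_nonneg).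
  assert (Z0 : forall x y, 0 <= Z x y) by (intros; apply sqn_nonneg).
  assert (Zeq : forall x y, Z x y = 0 -> x = x0 /\ y = y0).
  { intros x y E; apply sqn_eq0 in E; lra. }
  (* On the boundary of the square of half-width [r] below, [Z >= 2 q], whereas [Z a b < q]; this
     ratio is the source of the factor [1 / 2]. *)
  set (q := Z a b + 1); assert (Hq : 1 <= q) by (specialize (Z0 a b); unfold q; lra).
  set (r := Rabs x0 + Rabs y0 + 2 * q).
  assert (X0 := Rabs_pos x0); assert (Y0 := Rabs_pos y0).
  assert (Iab : Rabs a <= r /\ Rabs b <= r).
  { assert (Q1 : Rabs (a - x0) <= q /\ Rabs (b - y0) <= q).
    { assert (S1 := Rsqr_abs (a - x0)); assert (S2 := Rsqr_abs (b - y0)).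
      assert (S3 := Rle_0_sqr (a - x0)); assert (S4 := Rle_0_sqr (b - y0)).
      assert (A1 := Rabs_pos (a - x0)); assert (A2 := Rabs_pos (b - y0)).
      assert (EZ : Z a b = Rsqr (a - x0) + Rsqr (b - y0)) by (unfold Z, sqn, Rsqr; ring).
      unfold Rsqr in *; unfold q; split; nra. }
    unfold r; split;
      [replace a with ((a - x0) + x0) by ring | replace b with ((b - y0) + y0) by ring];
      (eapply Rle_trans; [apply Rabs_triang | lra]). }
  destruct (max_on_square S r) as (xm & ym & _ & _ & HM); [unfold r; lra | exact CS | ].
  set (M := S xm ym + 1) in *; assert (PM : 0 < M) by (specialize (S0 xm ym); unfold M; lra).
  assert (Zbd : forall x y, Rabs x = r \/ Rabs y = r -> 2 * q <= Z x y).
  { intros x y H.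
    assert (S1 := Rsqr_abs (x - x0)); assert (S2 := Rsqr_abs (y - y0)).
    assert (S3 := Rle_0_sqr (x - x0)); assert (S4 := Rle_0_sqr (y - y0)).
    assert (EZ : Z x y = Rsqr (x - x0) + Rsqr (y - y0)) by (unfold Z, sqn, Rsqr; ring).
    assert (T1 := Rabs_triang_inv x x0); assert (T2 := Rabs_triang_inv y y0).
    rewrite EZ; unfold Rsqr in *; destruct H as [E | E]; rewrite E in *; unfold r in *.
    - assert (2 * q <= Rabs (x - x0)) by lra; nra.
    - assert (2 * q <= Rabs (y - y0)) by lra; nra. }
  destruct (Req_dec (Z a b) 0) as [Ez | Nz].
  { destruct (Zeq a b Ez) as [-> ->]; exact (locally_2d_singleton _ _ _ L). }
  assert (Pz : 0 < Z a b) by (specialize (Z0 a b); lra).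
  assert (Bound : forall k, S a b <= M * (/ 2) ^ k).
  { intros k.
    assert (Pk : 0 < (2 * q) ^ k) by (apply pow_lt; lra).
    set (m := fun x y => S x y / Z x y ^ k).
    assert (Hm : m a b <= M / (2 * q) ^ k).
    { apply (maximum_principle (fun _ _ => 1) (fun _ _ => - 0) (fun _ _ => 1) m r); try tauto.
      - intros _ _; lra.
      - unfold r; lra.
      - now apply Rdiv_lt_0_compat.
      - intros x y; destruct (Req_dec (Z x y) 0) as [E | N].
        + destruct (Zeq x y E) as [-> ->].
          apply (continuity_2d_pt_ext_loc (fun _ _ => 0)); [ | apply continuity_2d_pt_const].
          eapply locally_2d_impl; [ | exact L]; apply locally_2d_forall.
          intros s t Est; unfold m, Rdiv; rewrite Est; ring.
        + apply continuity_2d_pt_mult; [apply CS | ].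
          apply continuity_2d_pt_inv; [ | now apply pow_nonzero].
          apply (continuity_1d_2d_pt_comp (fun z => z ^ k)); [ | apply CZ].
          apply derivable_continuous_pt, derivable_pt_pow.
      - intros x y Pm.
        assert (PS : 0 < S x y).
        { specialize (S0 x y); destruct (Req_dec (S x y) 0) as [E | ]; [ | lra].
          unfold m, Rdiv in Pm; rewrite E, Rmult_0_l in Pm; lra. }
        assert (PZ : 0 < Z x y).
        { specialize (Z0 x y); destruct (Req_dec (Z x y) 0) as [E | ]; [ | lra].
          destruct (Zeq x y E) as [-> ->].
          apply locally_2d_singleton in L; lra. }
        exists (fun s t => 1 * ln (S s t) + - INR k * ln (Z s t)); split.
        + assert (Op := second_order_op_lincomb _ _ _ 1 (- INR k) _ _ _ _ _ _
            (hol_ln_sqn _ _ _ _ _ x y UA Ht PS) (hol_ln_sqn _ _ _ _ _ x y UA HZ PZ)).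
          replace (1 * 0 + - INR k * 0) with 0 in Op by ring; exact Op.
        + eapply locally_2d_impl; [ | exact (locally_2d_and _ _ _ _
            (continuity_2d_pt_pos _ _ _ (CS x y) PS) (continuity_2d_pt_pos _ _ _ (CZ x y) PZ))].
          apply locally_2d_forall; intros s t [I1 I2].
          assert (I3 : 0 < Z s t ^ k) by now apply pow_lt.
          unfold m; rewrite <- (exp_ln (S s t / Z s t ^ k)) at 1; [ | now apply Rdiv_lt_0_compat].
          f_equal; rewrite ln_div, ln_pow; try assumption; ring.
      - intros x y Hx Hy Hb; unfold m, Rdiv.
        specialize (HM x y Hx Hy); specialize (Zbd x y Hb).
        apply Rmult_le_compat; [apply S0 | | unfold M; lra | ].
        + left; apply Rinv_0_lt_compat, pow_lt; lra.
        + apply Rinv_le_contravar; [exact Pk | apply pow_incr; lra]. }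
    assert (Pzk : 0 < Z a b ^ k) by now apply pow_lt.
    replace (S a b) with (m a b * Z a b ^ k) by (unfold m; field; lra).
    apply Rle_trans with (M / (2 * q) ^ k * Z a b ^ k); [apply Rmult_le_compat_r; lra | ].
    unfold Rdiv; rewrite Rmult_assoc, <- pow_inv, <- Rpow_mult_distr.
    apply Rmult_le_compat_l; [lra | ]; apply pow_incr; split.
    - apply Rmult_le_pos; [left; apply Rinv_0_lt_compat; lra | lra].
    - apply (Rmult_le_reg_l (2 * q)); [lra | ].
      replace (2 * q * (/ (2 * q) * Z a b)) with (Z a b) by (field; lra).
      unfold q; lra. }
  destruct (Req_dec (S a b) 0) as [ | N]; [assumption | exfalso].
  assert (PS : 0 < S a b) by (specialize (S0 a b); lra).
  destruct (pow_lt_1_zero (/ 2)) with (y := S a b / M) as [k Hk].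
  - rewrite Rabs_right; lra.
  - now apply Rdiv_lt_0_compat.
  - specialize (Hk k (le_n k)); specialize (Bound k).
    assert (0 < (/ 2) ^ k) by (apply pow_lt; lra).
    rewrite Rabs_right in Hk; [ | lra].
    apply (Rmult_lt_compat_l M) in Hk; [ | exact PM].
    replace (M * (S a b / M)) with (S a b) in Hk by (field; lra); lra.
Qed.

(* The gradients of [u] and [v] are complex conjugates of holomorphic functions. *)
Lemma harmonic_gradient_dichotomy (u u1 u2 u11 u12 u22 v v1 v2 v11 v12 v22 : R -> R -> R) :
  jet3 u u1 u2 u11 u12 u22 -> jet3 v v1 v2 v11 v12 v22 ->
  (forall x y, v11 x y + v22 x y = 0) ->
  (forall x y, sqn u1 u2 x y = 0 \/ sqn v1 v2 x y = 0) ->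
  (forall x y, u1 x y = 0 /\ u2 x y = 0) \/ (forall x y, v1 x y = 0 /\ v2 x y = 0).
Proof.
  intros Ju Jv Ev Or.
  destruct (classic (forall x y, sqn u1 u2 x y = 0)) as [A | A].
  { left; intros x y; now apply sqn_eq0. }
  right.
  assert (Ex : exists x0 y0, sqn u1 u2 x0 y0 <> 0).
  { apply not_all_ex_not in A; destruct A as [x0 A]; apply not_all_ex_not in A.
    destruct A as [y0 A]; now exists x0, y0. }
  destruct Ex as (x0 & y0 & N0).
  assert (C : continuity_2d_pt (sqn u1 u2) x0 y0).
  { destruct Ju as (? & ? & ? & ? & Ju); destruct (Ju x0 y0) as (_ & H1 & H2 & _).
    apply dpl_continuity in H1; apply dpl_continuity in H2.
    apply continuity_2d_pt_plus; now apply continuity_2d_pt_mult. }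
  assert (Hol := hol_directional 1 0 1 1 0 _ _ _ _ _ _ Jv).
  intros x y.
  (* Near [(x0, y0)] the gradient of [u] is nonzero, so that of [v] vanishes on an open set and
     hence everywhere. *)
  assert (Hz := unique_continuation _ _ x0 y0
                  (Hol (fun x y => ltac:(specialize (Ev x y); lra)))).
  assert (Eq : forall s t, sqn (fun x y => 1 * v1 x y + 0 * v2 x y + 0)
     (fun x y => (1 * 0 + 0 * 1) * v1 x y + (- 0 * 0 - 1 * 1) * v2 x y + 0) s t = sqn v1 v2 s t).
  { intros s t; unfold sqn; ring. }
  apply sqn_eq0; rewrite <- Eq; apply Hz.
  eapply locally_2d_impl; [ | exact (continuity_2d_pt_neq_0 _ _ _ C N0)].
  apply locally_2d_forall; intros s t N; rewrite Eq; destruct (Or s t); tauto.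
Qed.

(** * Graphs with [W] bounded by [1] *)

Lemma indefinite_form (a b c : R) : a * c - b * b < 0 ->
  exists d1 d2, (d1 <> 0 \/ d2 <> 0) /\ a * d1 * d1 + 2 * b * d1 * d2 + c * d2 * d2 < 0.
Proof.
  intros D; destruct (Rtotal_order a 0) as [L | [-> | G]].
  - exists 1, 0; split; [left; lra | lra].
  - assert (Nb : b <> 0) by nra.
    (* With [a = 0] and [d2 = 1] the form is [2 b d1 + c]; this [d1] gives it the value [-1]. *)
    exists (- (c + 1) / (2 * b)), 1; split; [right; lra | ].
    replace (_ + _) with (-1) by (field; lra); lra.
  - exists (- b), a; split; [right; lra | ].
    replace (_ + _) with (a * (a * c - b * b)) by ring; nra.
Qed.

Lemma spacelike_pos (f : R2 -> R2) (x : R2) : spacelike f ->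
  0 < metric f x i1 i1 /\ 0 < det_metric f x.
Proof.
  intros H.
  assert (S : metric f x i2 i1 = metric f x i1 i2) by (unfold metric, mink; simpl; ring).
  assert (P : 0 < metric f x i1 i1).
  { assert (N : ((1, 0) : R2) <> (0, 0)) by (intros E; injection E; lra).
    specialize (H x _ N); simpl in H; lra. }
  split; [exact P | ].
  (* At this vector the quadratic form equals [g11] times the determinant. *)
  assert (N : ((- metric f x i1 i2, metric f x i1 i1) : R2) <> (0, 0)) by (intros E; injection E; lra).
  specialize (H x _ N); simpl in H; rewrite S in H.
  unfold det_metric; rewrite S.
  apply (Rmult_lt_reg_l (metric f x i1 i1)); [exact P | lra].
Qed.

(** With [g = W A] and [A] constant, dividing the stationarity equations by [W] leaves linear
    equations with constant coefficients for both components. *)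
Lemma stationary_metric (f : R2 -> R2) : smooth f -> spacelike f -> stationary f ->
  let U := fun s t => fst (f (s, t)) in let V := fun s t => snd (f (s, t)) in
  Cinf U /\ Cinf V /\
  exists p q r, 0 < p /\ p * r - q * q = 1 /\ forall s t,
    0 < W f (s, t) /\
    1 + (D1 U s t * D1 U s t - D1 V s t * D1 V s t) = p * W f (s, t) /\
    D1 U s t * D2 U s t - D1 V s t * D2 V s t = q * W f (s, t) /\
    1 + (D2 U s t * D2 U s t - D2 V s t * D2 V s t) = r * W f (s, t) /\
    r * D1 (D1 U) s t - 2 * q * D2 (D1 U) s t + p * D2 (D2 U) s t = 0 /\
    r * D1 (D1 V) s t - 2 * q * D2 (D1 V) s t + p * D2 (D2 V) s t = 0.
Proof.
  intros Sm Sp St U V.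
  assert (CU : Cinf U) by (intros n x y; exact (proj1 (Sm n) x y)).
  assert (CV : Cinf V) by (intros n x y; exact (proj2 (Sm n) x y)).
  split; [exact CU | split; [exact CV | ]].
  assert (Lap : forall (u : R2 -> R), u = (fun z => fst (f z)) \/ u = (fun z => snd (f z)) ->
     Cinf (fun s t => u (s, t)) -> forall s t,
     metric f (s, t) i2 i2 * D1 (D1 (fun s t => u (s, t))) s t
     - 2 * metric f (s, t) i1 i2 * D2 (D1 (fun s t => u (s, t))) s t
     + metric f (s, t) i1 i1 * D2 (D2 (fun s t => u (s, t))) s t = 0).
  { intros u Hu Cu s t; destruct (spacelike_pos f (s, t) Sp) as [_ Pd].
    assert (E := stationary_laplacian f (s, t) (Rgt_not_eq _ _ Pd) (St (s, t)) u Hu).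
    change (pd i1 (pd i2 u) (s, t)) with (D1 (D2 (fun s t => u (s, t))) s t) in E.
    rewrite Cinf_Schwarz in E; [ | exact Cu].
    rewrite <- E.
    change (pd i1 (pd i1 u) (s, t)) with (D1 (D1 (fun s t => u (s, t))) s t).
    change (pd i2 (pd i1 u) (s, t)) with (D2 (D1 (fun s t => u (s, t))) s t).
    change (pd i2 (pd i2 u) (s, t)) with (D2 (D2 (fun s t => u (s, t))) s t).
    ring. }
  assert (LU := Lap _ (or_introl eq_refl) CU); assert (LV := Lap _ (or_intror eq_refl) CV).
  destruct (Cinf_jet3 _ CU) as (? & ? & ? & ? & JU); destruct (Cinf_jet3 _ CV) as (? & ? & ? & ? & JV).
  destruct (metric_constant (D1 U) (D2 U) (D1 (D1 U)) (D2 (D1 U)) (D2 (D2 U))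
              (D1 V) (D2 V) (D1 (D1 V)) (D2 (D1 V)) (D2 (D2 V))) as (p & q & r & H);
    try (intros s t; destruct (JU s t) as (? & ? & ? & ? & ? & ?),
           (JV s t) as (? & ? & ? & ? & ? & ?); solve [eauto using dpl_continuity]).
  - intros s t; exact (proj1 (spacelike_pos f (s, t) Sp)).
  - intros s t; destruct (spacelike_pos f (s, t) Sp) as [_ Pd].
    unfold det_metric in Pd.
    replace (metric f (s, t) i2 i1) with (metric f (s, t) i1 i2) in Pd
      by (unfold metric, mink; simpl; ring).
    exact Pd.
  - exact LU.
  - exact LV.
  - destruct (H 0 0) as (Pp & Det & _); exists p, q, r; split; [exact Pp | split; [exact Det | ]].
    intros s t; destruct (H s t) as (_ & _ & H1 & H2 & H3).
    assert (EW : W f (s, t) = sqrt (metric f (s, t) i1 i1 * metric f (s, t) i2 i2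
                                    - metric f (s, t) i1 i2 * metric f (s, t) i1 i2)).
    { unfold W, det_metric; do 2 f_equal; f_equal; unfold metric, mink; simpl; ring. }
    change (metric f (s, t) i1 i1 = p * sqrt (metric f (s, t) i1 i1 * metric f (s, t) i2 i2
                                    - metric f (s, t) i1 i2 * metric f (s, t) i1 i2)) in H1.
    change (metric f (s, t) i1 i2 = q * sqrt (metric f (s, t) i1 i1 * metric f (s, t) i2 i2
                                    - metric f (s, t) i1 i2 * metric f (s, t) i1 i2)) in H2.
    change (metric f (s, t) i2 i2 = r * sqrt (metric f (s, t) i1 i1 * metric f (s, t) i2 i2
                                    - metric f (s, t) i1 i2 * metric f (s, t) i1 i2)) in H3.
    rewrite <- EW in H1, H2, H3.
    assert (PW : 0 < W f (s, t)) by (apply sqrt_lt_R0, (spacelike_pos f (s, t) Sp)).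
    split; [exact PW | split; [exact H1 | split; [ | split; [exact H3 | ]]]].
    { rewrite <- H2; symmetry; apply Rplus_0_l. }
    specialize (LU s t); specialize (LV s t); rewrite H1, H2, H3 in LU, LV.
    split; apply (Rmult_eq_reg_l (W f (s, t))); try lra; rewrite Rmult_0_r;
      [rewrite <- LU | rewrite <- LV]; unfold U, V; ring.
Qed.

Lemma affine_plane_of_affine_linear (f : R2 -> R2) :
  affine_linear f -> affine_plane (graph f).
Proof.
  intros ([a1 a2] & [b1 b2] & [c1 c2] & E).
  exists ((0, 0), (c1, c2)), ((1, 0), (a1, a2)), ((0, 1), (b1, b2)); split.
  - intros s t H.
    assert (H1 := f_equal (fun Z : R4 => fst (fst Z)) H).
    assert (H2 := f_equal (fun Z : R4 => snd (fst Z)) H).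
    repeat (unfold plus, scal, mult, zero in *; simpl in *); lra.
  - intros Z; split.
    + intros [[s t] ->]; exists s, t; rewrite E.
      apply injective_projections; apply injective_projections;
        repeat (unfold plus, scal, mult; simpl); ring.
    + intros (s & t & ->); exists (s, t); rewrite E.
      apply injective_projections; apply injective_projections;
        repeat (unfold plus, scal, mult; simpl); ring.
Qed.

Lemma affine_linear_of_constant_gradients (f : R2 -> R2) (a1 b1 a2 b2 : R) :
  (forall s t, dpl (fun s t => fst (f (s, t))) s t a1 b1) ->
  (forall s t, dpl (fun s t => snd (f (s, t))) s t a2 b2) -> affine_linear f.
Proof.
  intros H1 H2; exists (a1, a2), (b1, b2), (f (0, 0)); intros [s t].
  assert (E1 := affine_of_constant_gradient _ _ _ H1 s t).
  assert (E2 := affine_of_constant_gradient _ _ _ H2 s t); cbn beta in E1, E2.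
  apply injective_projections; repeat (unfold plus, scal, mult; simpl); lra.
Qed.

(* [f1 - f2] and [f1 + f2] are null coordinates, in which
   [g(d, d) = |d|^2 + D_d (f1 - f2) D_d (f1 + f2)], so that [W = |d|^2 / A(d, d)]
   at a zero of either derivative. *)
Lemma W_at_critical_point (p q r w d1 d2 u1 u2 v1 v2 eps : R) :
  eps * eps = 1 ->
  1 + (u1 * u1 - v1 * v1) = p * w -> u1 * u2 - v1 * v2 = q * w ->
  1 + (u2 * u2 - v2 * v2) = r * w ->
  d1 * (1 * u1 + eps * v1 + 0) + d2 * (1 * u2 + eps * v2 + 0) = 0 ->
  ((p - 1) * d1 * d1 + 2 * q * d1 * d2 + (r - 1) * d2 * d2) * w
    = (d1 * d1 + d2 * d2) * (1 - w).
Proof.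
  intros E H1 H2 H3 Z.
  transitivity (d1 * d1 * (p * w) + 2 * d1 * d2 * (q * w) + d2 * d2 * (r * w)
     - (d1 * d1 + d2 * d2) * w); [ring | rewrite <- H1, <- H2, <- H3].
  assert (F : (d1 * (1 * u1 + eps * v1 + 0) + d2 * (1 * u2 + eps * v2 + 0))
            * (d1 * (1 * u1 - eps * v1) + d2 * (1 * u2 - eps * v2))
    = (d1 * u1 + d2 * u2) * (d1 * u1 + d2 * u2)
      - eps * eps * ((d1 * v1 + d2 * v2) * (d1 * v1 + d2 * v2))) by ring.
  rewrite Z, E in F; lra.
Qed.

Lemma W_bound_dichotomy (f : R2 -> R2) : smooth f -> spacelike f -> stationary f ->
  (forall x, W f x <= 1) \/ (forall x, 1 <= W f x) ->
  affine_linear f \/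
  ((forall x, W f x = 1) /\ harmonic (fun x => fst (f x)) /\
   exists eps c, eps * eps = 1 /\ forall x, snd (f x) = eps * fst (f x) + c).
Proof.
  intros Sm Sp St HW.
  destruct (stationary_metric f Sm Sp St) as (CU & CV & p & q & r & Pp & Det & H).
  set (U := fun s t => fst (f (s, t))) in *; set (V := fun s t => snd (f (s, t))) in *.
  assert (JU := Cinf_jet3 _ CU); assert (JV := Cinf_jet3 _ CV).
  assert (J := fun eps => jet3_lincomb 1 eps _ _ _ _ _ _ _ _ _ _ _ _ JU JV).
  assert (L : forall eps x y,
     r * (1 * D1 (D1 U) x y + eps * D1 (D1 V) x y + 0)
     - 2 * q * (1 * D2 (D1 U) x y + eps * D2 (D1 V) x y + 0)
     + p * (1 * D2 (D2 U) x y + eps * D2 (D2 V) x y + 0) = 0).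
  { intros eps x y; destruct (H x y) as (_ & _ & _ & _ & LU & LV).
    assert (Z := f_equal (Rmult eps) LV); lra. }
  assert (Null : forall e, e * e = 1 ->
     (forall x y, 1 * D1 U x y + e * D1 V x y + 0 = 0 /\ 1 * D2 U x y + e * D2 V x y + 0 = 0) ->
     p = 1 /\ q = 0 /\ r = 1 ->
     (forall x, W f x = 1) /\ harmonic (fun x => fst (f x)) /\
     exists eps c, eps * eps = 1 /\ forall x, snd (f x) = eps * fst (f x) + c).
  { intros e E G (-> & -> & ->); split; [ | split; [split | ]].
    (* The two components have [x]-derivatives of equal square, so [g11 = 1], while [g11 = W]
       because [p = 1]. *)
    - intros [s t]; destruct (H s t) as (_ & H1 & _); destruct (G s t) as [G1 _].
      assert (Z1 := f_equal (Rmult (D1 U s t - e * D1 V s t)) G1).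
      assert (Z2 := f_equal (Rmult (D1 V s t * D1 V s t)) E); lra.
    - intros a b; exact (CU 2%nat a b).
    - intros [s t]; destruct (H s t) as (_ & _ & _ & _ & LU & _).
      transitivity (1 * D1 (D1 U) s t - 2 * 0 * D2 (D1 U) s t + 1 * D2 (D2 U) s t);
        [ | exact LU].
      change (D1 (D1 U) s t + D2 (D2 U) s t
        = 1 * D1 (D1 U) s t - 2 * 0 * D2 (D1 U) s t + 1 * D2 (D2 U) s t); ring.
    - exists (- e), (e * (1 * U 0 0 + e * V 0 0 + 0)); split; [lra | ]; intros [s t].
      assert (Eq := affine_of_constant_gradient (fun s t => 1 * U s t + e * V s t + 0) 0 0).
      change (V s t = - e * U s t + e * (1 * U 0 0 + e * V 0 0 + 0)).
      assert (Eq' : 1 * U s t + e * V s t + 0 = 1 * U 0 0 + e * V 0 0 + 0 + 0 * s + 0 * t).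
      { apply Eq; intros x y; destruct (J e) as (? & ? & ? & ? & Je), (G x y) as [G1 G2].
        destruct (Je x y) as (Dl & _); eapply dpl_eq; [exact Dl | exact G1 | exact G2]. }
      assert (Z1 := f_equal (Rmult e) Eq'); assert (Z2 := f_equal (Rmult (V s t)) E); lra. }
  destruct (classic (p = 1 /\ q = 0 /\ r = 1)) as [I | NI].
  - assert (I' := I); destruct I' as (-> & -> & ->).
    destruct (harmonic_gradient_dichotomy _ _ _ _ _ _ _ _ _ _ _ _ (J (-1)) (J 1)) as [G | G].
    + intros x y; specialize (L 1 x y); lra.
    + intros x y; destruct (H x y) as (_ & H1 & H2 & H3 & _); unfold sqn.
      apply Rmult_integral.
      (* The product of the squared gradients of [f1 - f2] and [f1 + f2] is
         [(g11 - g22)^2 + 4 g12^2], which is zero for [g = W I]. *)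
      replace (_ * _) with
       (((1 + (D1 U x y * D1 U x y - D1 V x y * D1 V x y)) - (1 + (D2 U x y * D2 U x y - D2 V x y * D2 V x y)))
       * ((1 + (D1 U x y * D1 U x y - D1 V x y * D1 V x y)) - (1 + (D2 U x y * D2 U x y - D2 V x y * D2 V x y)))
       + 4 * ((D1 U x y * D2 U x y - D1 V x y * D2 V x y) * (D1 U x y * D2 U x y - D1 V x y * D2 V x y)))
       by ring.
      rewrite H1, H2, H3; ring.
    + right; exact (Null (-1) ltac:(ring) G I).
    + right; exact (Null 1 ltac:(ring) G I).
  - left.
    (* As [det A = 1], [det (A - I) = 2 - tr A]; and [(p - r)^2 + 4 q^2 = (tr A)^2 - 4] forces
       [A = I] if [tr A <= 2]. So [A - I] is indefinite. *)
    assert (Ds : (p - 1) * (r - 1) - q * q < 0).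
    { replace (_ - _) with (2 - (p + r)) by lra.
      destruct (Rlt_or_le 2 (p + r)) as [ | B]; [lra | exfalso; apply NI].
      assert (Pr : 0 < r) by nra.
      assert (Q : (p - r) * (p - r) + 4 * (q * q) = (p + r) * (p + r) - 4) by lra.
      assert (B2 : (p + r) * (p + r) <= 2 * 2) by (apply Rmult_le_compat; lra).
      assert (Q1 := Rle_0_sqr (p - r)); assert (Q2 := Rle_0_sqr q); unfold Rsqr in *.
      assert (Eq : q = 0) by (apply Rsqr_0_uniq; unfold Rsqr; lra).
      assert (Epr : p - r = 0) by (apply Rsqr_0_uniq; unfold Rsqr; lra).
      nra. }
    (* At a zero of either derivative, [(A - I)(d, d)] has the sign of [1 - W]. Choosing [d] with a
       negative value when [W <= 1], and a positive one when [W >= 1], excludes such zeros. *)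
    assert (Dir : exists d1 d2, (d1 <> 0 \/ d2 <> 0) /\
      forall eps x y, eps * eps = 1 -> d1 * (1 * D1 U x y + eps * D1 V x y + 0)
                            + d2 * (1 * D2 U x y + eps * D2 V x y + 0) <> 0).
    { assert (Pd : forall d1 d2 : R, d1 <> 0 \/ d2 <> 0 -> 0 < d1 * d1 + d2 * d2).
      { intros d1 d2 N; assert (Q1 := Rle_0_sqr d1); assert (Q2 := Rle_0_sqr d2).
        destruct N as [N | N]; apply Rsqr_pos_lt in N; unfold Rsqr in *; lra. }
      destruct HW as [HW | HW].
      - destruct (indefinite_form (p - 1) q (r - 1) Ds) as (d1 & d2 & N & F).
        exists d1, d2; split; [exact N | ]; intros eps x y E Z; specialize (Pd d1 d2 N).
        destruct (H x y) as (PW & H1 & H2 & H3 & _); specialize (HW (x, y)).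
        assert (K := W_at_critical_point _ _ _ _ _ _ _ _ _ _ _ E H1 H2 H3 Z).
        assert (0 <= (d1 * d1 + d2 * d2) * (1 - W f (x, y))) by (apply Rmult_le_pos; lra).
        rewrite <- K in *; nra.
      - destruct (indefinite_form (- (p - 1)) (- q) (- (r - 1))) as (d1 & d2 & N & F); [lra | ].
        exists d1, d2; split; [exact N | ]; intros eps x y E Z; specialize (Pd d1 d2 N).
        destruct (H x y) as (PW & H1 & H2 & H3 & _); specialize (HW (x, y)).
        assert (K := W_at_critical_point _ _ _ _ _ _ _ _ _ _ _ E H1 H2 H3 Z).
        assert (0 <= (d1 * d1 + d2 * d2) * (W f (x, y) - 1)) by (apply Rmult_le_pos; lra).
        assert (0 < ((p - 1) * d1 * d1 + 2 * q * d1 * d2 + (r - 1) * d2 * d2) * W f (x, y))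
          by (apply Rmult_lt_0_compat; lra).
        lra. }
    destruct Dir as (d1 & d2 & N & Dir).
    destruct (constant_gradient_of_nonvanishing p q r d1 d2 _ _ _ _ _ _ Pp Det N (J (-1)) (L (-1)))
      as (a1 & b1 & G1); [intros x y; apply Dir; ring | ].
    destruct (constant_gradient_of_nonvanishing p q r d1 d2 _ _ _ _ _ _ Pp Det N (J 1) (L 1))
      as (a2 & b2 & G2); [intros x y; apply Dir; ring | ].
    eapply affine_linear_of_constant_gradients; intros s t.
    + eapply (dpl_ext _ U); [ | exact (dpl_lincomb (1 / 2) (1 / 2) 0 _ _ _ _ _ _ _ _ (G1 s t) (G2 s t))].
      intros; simpl; field.
    + eapply (dpl_ext _ V); [ | exact (dpl_lincomb (- (1 / 2)) (1 / 2) 0 _ _ _ _ _ _ _ _ (G1 s t) (G2 s t))].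
      intros; simpl; field.
Qed.

Theorem corollary4p1 (f : R2 -> R2)
  (f_smooth : smooth f) (f_spacelike : spacelike f)
  (f_stationary : stationary f) :
  ((forall x : R2, W f x <= 1) \/ (forall x : R2, 1 <= W f x) ->
     affine_linear f \/
     exists (h : R2 -> R) (y0 y1 : R2),
       harmonic h /\ ~ affine_linear h /\
       lightlike y0 /\ y0 <> zero /\
       forall x : R2, f x = plus (scal (h x) y0) y1) /\
  ((forall x : R2, W f x < 1) \/ (forall x : R2, 1 < W f x) ->
     affine_linear f /\ affine_plane (graph f)).
Proof.
  assert (Dich := W_bound_dichotomy f f_smooth f_spacelike f_stationary).
  split; intros HW.
  - destruct (classic (affine_linear f)) as [A | NA]; [now left | right].
    destruct (Dich HW) as [A | (_ & Hh & eps & c & E & Ef)]; [contradiction | ].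
    (* [h] is the spacelike component, and [(1, eps)] is lightlike as [eps^2 = 1]. Were [h] affine,
       [f] would be too. *)
    exists (fun x => fst (f x)), (1, eps), (0, c).
    assert (Ey : forall x, f x = plus (scal (fst (f x)) ((1, eps) : R2)) ((0, c) : R2)).
    { intros x; apply injective_projections; repeat (unfold plus, scal, mult; simpl);
        [ring | rewrite Ef; ring]. }
    split; [exact Hh | split; [ | split; [ | split; [ | exact Ey]]]].
    + intros (a & b & d & Eh); apply NA.
      exists (scal a ((1, eps) : R2)), (scal b ((1, eps) : R2)),
        (plus (scal d ((1, eps) : R2)) ((0, c) : R2)).
      intros x; rewrite Ey, Eh.
      apply injective_projections; repeat (unfold plus, scal, mult; simpl); ring.
    + unfold lightlike, mink; simpl; lra.
    + intros Z; apply (f_equal fst) in Z; simpl in Z; unfold zero in Z; simpl in Z; lra.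
  (* The other alternative has [W = 1] everywhere, against the strict bound. *)
  - assert (HA : affine_linear f).
    { destruct Dich as [A | (W1 & _)]; [ | exact A | ].
      - destruct HW as [HW | HW]; [left | right]; intros x; specialize (HW x); lra.
      - exfalso; destruct HW as [HW | HW]; specialize (HW (0, 0)); specialize (W1 (0, 0)); lra. }
    split; [exact HA | now apply affine_plane_of_affine_linear].
Qed.
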